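(* Let $E$ be a quojection which is an Asplund space. If $F$ is a closed vector subspace of $E$ which is a quojection, then $F$ is an Asplund space.
   Context: All vector spaces are real; all topological vector spaces are Hausdorff; ''lcs'' means locally convex space. A lcs $E$ is Asplund if every continuous convex function $f:D\to\mathbb{R}$, where $D\subset E$ is a nonempty open convex set, is Fréchet differentiable on a dense $G_\delta$ subset of $D$. Here $f$ is Fréchet differentiable at $x\in D$ if there is $x^*\in E'$ with $\lim_{t\to0}\frac{f(x+ty)-f(x)}{t}=x^*(y)$ uniformly for $y$ in each bounded subset of $E$. Let $(E_n)_n$ be a sequence of Banach spaces and, for $m\ge n$, let $P_{nm}:E_m\to E_n$ be continuous linear maps with $P_{nn}$ the identity and $P_{nm}\circ P_{ms}=P_{ns}$ for $s\ge m\ge n$. The projective limit is $E=\{(x(n))\in\prod_nE_n: P_{nm}(x(m))=x(n),\ m\ge n\}$ with the product topology, and the canonical projections are $P_n:E\to E_n$, $(x(m))_m\mapsto x(n)$. $E$ is a strict projective limit of $(E_n)_n$ if each $P_n$ is surjective. A quojection is a Fréchet space (metrizable and complete lcs) that is (isomorphic to) the strict projective limit of such a sequence of Banach spaces. *)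

(* Defs.v *)
From HB Require Import structures.
From mathcomp Require Import all_boot all_order all_algebra.
From mathcomp Require Import all_classical all_reals all_analysis.
From mathcomp Require Import borel_hierarchy.
Set Implicit Arguments.
Unset Strict Implicit.
Unset Printing Implicit Defensive.
Import Order.TTheory GRing.Theory Num.Theory.
Import numFieldNormedType.Exports.
Local Open Scope classical_set_scope.
Local Open Scope ring_scope.

(* A real lcs is rendered by [tvsType R], whose local convexity is part of the
   interface. [tvsType] does not include the Hausdorff axiom: it is a conjunct of
   [asplund], and follows from [metrizable] for Frechet spaces. *)

Section SubTvs.
Context {R : realType} {E : tvsType R}.

(* A vector subspace of E with the induced linear structure and the induced
   topology. *)
Record sub_tvs (F : submodClosed E) : Type :=
  SubTvs { sub_tvs_val :> E; _ : sub_tvs_val \in F }.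

Variable F : submodClosed E.

HB.instance Definition _ := [isSub for @sub_tvs_val F].
HB.instance Definition _ := [Choice of sub_tvs F by <:].
HB.instance Definition _ := [SubChoice_isSubLmodule of sub_tvs F by <:].
HB.instance Definition _ := Topological.copy (sub_tvs F)
  (initial_topology (\val : sub_tvs F -> E)).

Lemma sub_tvs_val_continuous : continuous (\val : sub_tvs F -> E).
Proof. exact: (@initial_continuous (sub_tvs F) E \val). Qed.

Lemma sub_tvs_continuous (T : topologicalType) (g : T -> sub_tvs F) :
  continuous (fun t => \val (g t)) -> continuous g.
Proof. by move=> cg; exact: (@continuous_comp_initial _ _ _ \val). Qed.

Let sub_tvs_add_continuous :
  continuous (fun x : sub_tvs F * sub_tvs F => x.1 + x.2).
Proof.
apply: sub_tvs_continuous.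
rewrite (_ : (fun _ => _) = (fun z : E * E => z.1 + z.2) \o
  (fun z : sub_tvs F * sub_tvs F => (\val z.1, \val z.2))); last first.
  by apply/funext => z; exact: (raddfD (\val : {additive sub_tvs F -> E})).
move=> z; apply: continuous_comp; last exact: add_continuous.
by apply: cvg_pair; apply: continuous_comp; [exact: cvg_fst|
  exact: sub_tvs_val_continuous|exact: cvg_snd|exact: sub_tvs_val_continuous].
Qed.

Let sub_tvs_scale_continuous :
  continuous (fun z : R^o * sub_tvs F => z.1 *: z.2).
Proof.
apply: sub_tvs_continuous.
rewrite (_ : (fun _ => _) = (fun z : R^o * E => z.1 *: z.2) \o
  (fun z : R^o * sub_tvs F => (z.1, \val z.2))); last first.
  by apply/funext => z; exact: (linearZZ (\val : {linear sub_tvs F -> E})).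
move=> z; apply: continuous_comp; last exact: scale_continuous.
move: z => [k z]; apply: (@cvg_pair _ _ _ _ (nbhs (k : R^o)) (nbhs (\val z))).
  exact: cvg_fst.
apply: (@continuous_comp _ _ _ (@snd R^o (sub_tvs F)) \val (k, z)).
  exact: cvg_snd.
exact: sub_tvs_val_continuous.
Qed.

Let sub_tvs_locally_convex : exists2 B : set_system (sub_tvs F),
  (forall b, b \in B -> convex_set b) & basis B.
Proof.
have [B Bcvx [Bo Bb]] := @locally_convex R E.
exists [set (\val : sub_tvs F -> E) @^-1` b | b in B].
  move=> _ /[!inE] -[b Bb0 <-] x y l /[!inE]/= bx by0.
  have := Bcvx b (mem_set Bb0) (\val x) (\val y) l (mem_set bx) (mem_set by0).
  by rewrite inE.
split; first by move=> _ [b /Bo bo <-]; exists b.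
move=> x A [_ [[V Vo <-] Vx] VA].
have [b [Bb0 bx] bV] := Bb (\val x) V (open_nbhs_nbhs (conj Vo Vx)).
exists (\val @^-1` b); first by split; [exists b|].
by move=> y /bV/VA.
Qed.

(* This factory provides the translation-invariant uniform structure only. *)
HB.instance Definition _ := PreTopologicalLmod_isTvs.Build R (sub_tvs F)
  sub_tvs_add_continuous sub_tvs_scale_continuous sub_tvs_locally_convex.
HB.instance Definition _ :=
  PreTopologicalNmodule_isTopologicalNmodule.Build (sub_tvs F) sub_tvs_add_continuous.
HB.instance Definition _ :=
  TopologicalNmodule_isTopologicalLmodule.Build R (sub_tvs F) sub_tvs_scale_continuous.
HB.instance Definition _ := Uniform_isTvs.Build R (sub_tvs F) sub_tvs_locally_convex.

End SubTvs.

Section TvsProd.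
Context {R : realType} {I : eqType}.

(* The product of a family of lcs: coordinatewise operations, product
   topology. *)
Record tvs_prod (E : I -> tvsType R) : Type :=
  TvsProd { tvs_prod_val : prod_topology E }.

Arguments tvs_prod_val {E}.

Variable E : I -> tvsType R.
Local Notation V := (tvs_prod E).

Definition tvs_coord (i : I) (x : V) : E i := tvs_prod_val x i.

Lemma tvs_prodP (x y : V) : (forall i, tvs_coord i x = tvs_coord i y) -> x = y.
Proof.
by case: x y => [x] [y] /= xy; congr TvsProd; apply: functional_extensionality_dep.
Qed.

HB.instance Definition _ := gen_eqMixin V.
HB.instance Definition _ := gen_choiceMixin V.

Let prod0 : V := TvsProd (fun=> 0).
Let prod_opp (x : V) : V := TvsProd (fun i => - tvs_coord i x).
Let prod_add (x y : V) : V := TvsProd (fun i => tvs_coord i x + tvs_coord i y).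
Let prod_scale (a : R) (x : V) : V := TvsProd (fun i => a *: tvs_coord i x).

Let prod_addA : associative prod_add.
Proof. by move=> x y z; apply: tvs_prodP => i; exact: addrA. Qed.
Let prod_addC : commutative prod_add.
Proof. by move=> x y; apply: tvs_prodP => i; exact: addrC. Qed.
Let prod_add0 : left_id prod0 prod_add.
Proof. by move=> x; apply: tvs_prodP => i; exact: add0r. Qed.
Let prod_addN : left_inverse prod0 prod_opp prod_add.
Proof. by move=> x; apply: tvs_prodP => i; exact: addNr. Qed.

HB.instance Definition _ :=
  GRing.isZmodule.Build V prod_addA prod_addC prod_add0 prod_addN.

Let prod_scaleA a b (x : V) :
  prod_scale a (prod_scale b x) = prod_scale (a * b) x.
Proof. by apply: tvs_prodP => i; exact: scalerA. Qed.
Let prod_scale1 : left_id 1 prod_scale.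
Proof. by move=> x; apply: tvs_prodP => i; exact: scale1r. Qed.
Let prod_scaleDr : right_distributive prod_scale +%R.
Proof. by move=> a x y; apply: tvs_prodP => i; exact: scalerDr. Qed.
Let prod_scaleDl (x : V) : {morph prod_scale^~ x : a b / a + b}.
Proof. by move=> a b; apply: tvs_prodP => i; exact: scalerDl. Qed.

HB.instance Definition _ := GRing.Zmodule_isLmodule.Build R V
  prod_scaleA prod_scale1 prod_scaleDr prod_scaleDl.

Lemma tvs_coord_is_linear i : linear (tvs_coord i).
Proof. by []. Qed.

HB.instance Definition _ i :=
  GRing.isLinear.Build R V (E i) *:%R (tvs_coord i) (tvs_coord_is_linear i).

HB.instance Definition _ := Topological.copy V
  (@initial_topology V (prod_topology E) tvs_prod_val).

Lemma tvs_coord_continuous i : continuous (tvs_coord i).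
Proof.
move=> x.
apply: (@continuous_comp V (prod_topology E) (E i) tvs_prod_val
  (@proj I E i)).
  exact: (@initial_continuous V (prod_topology E) tvs_prod_val).
exact: (@proj_continuous I E i).
Qed.

Lemma tvs_prod_cvg (F : set_system V) (x : V) : Filter F ->
  (forall i, tvs_coord i @ F --> tvs_coord i x) -> F --> x.
Proof.
move=> FF Fx.
suff Fx' : tvs_prod_val @ F --> tvs_prod_val x.
  move=> A [_ [[B Bo <-] Bx] BA].
  have : (tvs_prod_val @ F) B by apply: Fx'; exact: open_nbhs_nbhs.
  by move=> /= FB; apply: filterS FB => y /BA.
apply/cvg_sup => i A [_ [[B Bo <-] Bx] BA].
have : (tvs_coord i @ F) B by apply: Fx; exact: open_nbhs_nbhs.
by move=> /= FB; rewrite /nbhs/=; apply: filterS FB => y /BA.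
Qed.

Lemma tvs_prod_continuous (T : topologicalType) (g : T -> V) :
  (forall i, continuous (fun t => tvs_coord i (g t))) -> continuous g.
Proof. by move=> cg t; apply: tvs_prod_cvg => i; exact: cg. Qed.

Let prod_add_continuous : continuous (fun x : V * V => x.1 + x.2).
Proof.
apply: tvs_prod_continuous => i z.
apply: (@continuous_comp _ _ _
  (fun z : V * V => (tvs_coord i z.1, tvs_coord i z.2))
  (fun z : E i * E i => z.1 + z.2)); last exact: add_continuous.
by apply: cvg_pair; apply: continuous_comp; [exact: cvg_fst|
  exact: tvs_coord_continuous|exact: cvg_snd|exact: tvs_coord_continuous].
Qed.

Let prod_scale_continuous : continuous (fun z : R^o * V => z.1 *: z.2).
Proof.
apply: tvs_prod_continuous => i -[k z].
apply: (@continuous_comp _ _ _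
  (fun z : R^o * V => (z.1, tvs_coord i z.2))
  (fun z : R^o * E i => z.1 *: z.2)); last exact: scale_continuous.
apply: (@cvg_pair _ _ _ _ (nbhs (k : R^o)) (nbhs (tvs_coord i z))).
  exact: cvg_fst.
apply: (@continuous_comp _ _ _ (@snd R^o V) (tvs_coord i) (k, z)).
  exact: cvg_snd.
exact: tvs_coord_continuous.
Qed.

Let prod_locally_convex : exists2 B : set_system V,
  (forall b, b \in B -> convex_set b) & basis B.
Proof.
exists [set b : set V | open b /\ convex_set b]; first by move=> b /[!inE] -[].
split; first by move=> b [].
move=> x; pose G := filter_from [set U : set V | (open U /\ convex_set U) /\ U x] id.
have FG : Filter G.
  apply: filter_from_filter.
    by exists setT; split=> //; split; [exact: openT|move=> *; rewrite inE].
  move=> U W [[Uo Uc] Ux] [[Wo Wc] Wx]; exists (U `&` W) => //; split=> //.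
  split; first exact: openI.
  move=> a b l /[!inE] -[Ua Wa] [Ub Wb]; split; apply/set_mem.
    by apply: Uc; exact/mem_set.
  by apply: Wc; exact/mem_set.
apply: (@tvs_prod_cvg G) => i A nA.
have [B Bcvx [Bo Bb]] := @locally_convex R (E i).
have [b [Bb0 bx] bA] := Bb _ _ nA.
exists (tvs_coord i @^-1` b); last by move=> y /bA.
split=> //; split.
  apply: open_comp; [move=> ? _; exact: tvs_coord_continuous|exact: Bo].
move=> y z l /[!inE]/= by0 bz.
have := Bcvx b (mem_set Bb0) (tvs_coord i y) (tvs_coord i z) l
  (mem_set by0) (mem_set bz).
by rewrite inE.
Qed.

HB.instance Definition _ := PreTopologicalLmod_isTvs.Build R V
  prod_add_continuous prod_scale_continuous prod_locally_convex.
HB.instance Definition _ :=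
  PreTopologicalNmodule_isTopologicalNmodule.Build V prod_add_continuous.
HB.instance Definition _ :=
  TopologicalNmodule_isTopologicalLmodule.Build R V prod_scale_continuous.
HB.instance Definition _ := Uniform_isTvs.Build R V prod_locally_convex.

End TvsProd.

Section BanachSpectrum.
Context {R : realType}.

(* A projective sequence of real Banach spaces. [bs_map n m : E_m -> E_n] is
   P_nm; it is meaningful only for n <= m, and unconstrained otherwise. *)
Record banach_spectrum : Type := BanachSpectrum {
  bs_space :> nat -> completeNormedModType R;
  bs_map : forall n m : nat, {linear bs_space m -> bs_space n};
  bs_map_continuous : forall n m, (n <= m)%N -> continuous (bs_map n m);
  bs_map_id : forall n x, bs_map n n x = x;
  bs_map_comp : forall n m s, (n <= m <= s)%N ->
    forall x, bs_map n m (bs_map m s x) = bs_map n s x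
}.

Variable S : banach_spectrum.

Definition bs_prod : tvsType R := tvs_prod (fun n => S n : tvsType R).

Definition projlim_pred : {pred bs_prod} := fun x =>
  `[< forall n m, (n <= m)%N -> bs_map S n m (tvs_coord m x) = tvs_coord n x >].

Lemma projlim_submod_closed : submod_closed projlim_pred.
Proof.
split=> [|a x y /asboolP xP /asboolP yP]; apply/asboolP => n m nm.
  by rewrite !linear0.
by rewrite !linearP /= xP// yP.
Qed.

HB.instance Definition _ :=
  GRing.isSubmodClosed.Build R bs_prod projlim_pred projlim_submod_closed.

Definition projlim : tvsType R := sub_tvs projlim_pred.

Definition projlim_proj (n : nat) (x : projlim) : S n :=
  tvs_coord n (sub_tvs_val x).

Definition strict_spectrum : Prop :=
  forall (n : nat) (y : S n), exists x : projlim, projlim_proj n x = y.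

End BanachSpectrum.

Section Notions.
Context {R : realType}.

Definition tvs_isomorphic (E F : tvsType R) : Prop :=
  exists (f : {linear E -> F}) (g : {linear F -> E}),
    [/\ cancel f g, cancel g f, continuous f & continuous g].

Definition metrizable (T : topologicalType) : Prop :=
  exists d : T -> T -> R,
    [/\ forall x y, 0 <= d x y,
        forall x y, d x y = 0 <-> x = y,
        forall x y, d x y = d y x,
        forall x y z, d x z <= d x y + d y z
      & forall x, nbhs x = filter_from [set e : R | 0 < e]
                             (fun e => [set y | d x y < e])].

(* The uniform structure carried by a [tvsType] induces its topology but need
   not be the translation-invariant one, so Cauchy filters are defined from the
   neighbourhoods of 0 and not from [entourage]. *)
Definition tvs_cauchy (E : tvsType R) (G : set_system E) : Prop :=
  forall U : set E, nbhs 0 U ->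
    exists2 A, G A & forall x y, A x -> A y -> U (x - y).

Definition tvs_complete (E : tvsType R) : Prop :=
  forall G : set_system E, ProperFilter G -> tvs_cauchy G ->
    exists x : E, G --> x.

Definition frechet_space (E : tvsType R) : Prop :=
  metrizable E /\ tvs_complete E.

Definition quojection (E : tvsType R) : Prop :=
  frechet_space E /\
  exists S : banach_spectrum, strict_spectrum S /\ tvs_isomorphic E (projlim S).

Definition tvs_bounded (E : tvsType R) (B : set E) : Prop :=
  forall U : set E, nbhs 0 U ->
    \forall r \near +oo, B `<=` [set r *: u | u in U].

(* Only the values of f near x matter: for a bounded set B, the points x + t y
   with y in B all lie in a given neighbourhood of x when t is small. *)
Definition frechet_differentiable (E : tvsType R) (f : E -> R^o) (x : E) : Prop :=
  exists2 df : {linear E -> R^o}, continuous df &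
    forall B : set E, tvs_bounded B ->
      {uniform B, (fun (t : R) (y : E) => (f (x + t *: y) - f x) / t) @ 0^'
                  --> (df : E -> R^o)}.

(* A function D -> R is represented by a function on E, whose values outside
   the open set D are irrelevant below. *)
Definition asplund (E : tvsType R) : Prop :=
  hausdorff_space E /\
  forall (D : set E) (f : E -> R^o),
    D !=set0 -> open D -> convex_set D ->
    {within D, continuous f} -> convex_function D f ->
    exists G : set E, [/\ G `<=` D, Gdelta G, D `<=` closure G &
      forall x, G x -> frechet_differentiable f x].

End Notions.

Arguments metrizable R T : clear implicits.

(* Main.v *)
Require Import Defs.
From HB Require Import structures.
From mathcomp Require Import all_boot all_order all_algebra.
From mathcomp Require Import all_classical all_reals all_analysis.
From mathcomp Require Import borel_hierarchy.
From mathcomp Require Import ring lra.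
Import Order.TTheory GRing.Theory Num.Theory.
Import numFieldNormedType.Exports.
Local Open Scope classical_set_scope.
Local Open Scope ring_scope.
Set Implicit Arguments.
Unset Strict Implicit.
Unset Printing Implicit Defensive.

(* Call a seminorm q flat if every sublinear function bounded by a multiple of q
   has, for each e > 0, a point and a scale at which its symmetric second
   difference over the q-unit ball is at most e times the scale. Let
   P_m : E -> E_m and Q_n : F -> F_n be the Banach quotients of E and F.

   If E is Asplund, every |P_m| is flat, because the unit ball of E_m is the
   image of a bounded subset of E: lift along the spectrum, using the open
   mapping theorem at each step.

   Flatness passes to |Q_n|. A sublinear s <= L |Q_n| on F is dominated on F by
   some c |P_m|; take g minimal among the sublinear functions on E below c |P_m|
   and above s on F. If g is nearly flat at z, minimality yields y in F at which
   s exceeds the support function of a set of linear functionals below g that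
   omits a small slice in the direction z, and s is nearly flat at y. This gives
   flatness over the |P_m|-unit ball of F; since a multiple of it has
   |Q_n|-dense trace in the |Q_n|-unit ball (Baire), it gives flatness of |Q_n|.

   A continuous convex function f on an open D in F is locally Lipschitz for a
   single |Q_n|. Applying flatness to the support function of the subgradients of
   f near a given point produces nearby open sets on which the second differences
   of f are small at all small scales; Baire's theorem in F_n concludes. *)

(** * Sublinear functions and seminorms on a vector space *)

Section Sublinear.
Context {R : realType}.

Definition sublinear (V : lmodType R) (g : V -> R) : Prop :=
  (forall x y, g (x + y) <= g x + g y) /\
  (forall t x, 0 <= t -> g (t *: x) = t * g x).

Definition seminorm (V : lmodType R) (q : V -> R) : Prop :=
  (forall x y, q (x + y) <= q x + q y) /\
  (forall t x, q (t *: x) = `|t| * q x).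

Lemma sublinear0 (V : lmodType R) (g : V -> R) : sublinear g -> g 0 = 0.
Proof. by move=> [_ gZ]; rewrite -(scale0r 0) gZ// mul0r. Qed.

Lemma seminorm_sublinear (V : lmodType R) (q : V -> R) :
  seminorm q -> sublinear q.
Proof. by move=> [qD qZ]; split=> // t x t0; rewrite qZ ger0_norm. Qed.

Lemma seminorm0 (V : lmodType R) (q : V -> R) : seminorm q -> q 0 = 0.
Proof. by move=> /seminorm_sublinear; exact: sublinear0. Qed.

Lemma seminormN (V : lmodType R) (q : V -> R) : seminorm q ->
  forall x, q (- x) = q x.
Proof. by move=> [_ qZ] x; rewrite -scaleN1r qZ normrN1 mul1r. Qed.

Lemma seminorm_ge0 (V : lmodType R) (q : V -> R) : seminorm q ->
  forall x, 0 <= q x.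
Proof.
move=> sq x; have := sq.1 x (- x).
by rewrite subrr (seminorm0 sq) (seminormN sq); lra.
Qed.

Lemma seminormB (V : lmodType R) (q : V -> R) : seminorm q ->
  forall x y, q (x - y) <= q x + q y.
Proof. by move=> sq x y; rewrite -(seminormN sq y); exact: sq.1. Qed.

Lemma seminorm_distC (V : lmodType R) (q : V -> R) : seminorm q ->
  forall x y, q (x - y) = q (y - x).
Proof. by move=> sq x y; rewrite -opprB seminormN. Qed.

Lemma seminorm_norm (V : lmodType R) (X : normedModType R)
  (Q : {linear V -> X}) : seminorm (fun x => `|Q x|).
Proof.
by split=> [x y|t x]; [rewrite linearD ler_normD|rewrite linearZ/= normrZ].
Qed.

Lemma seminorm_comparison (V : lmodType R) (p q : V -> R) (r : R) :
  seminorm p -> seminorm q -> 0 < r -> (forall x, p x < r -> q x < 1) ->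
  forall x, q x <= r^-1 * p x.
Proof.
move=> sp sq r0 pq x; apply/ler_addgt0Pr => e e0.
have p0 : 0 <= r^-1 * p x by rewrite mulr_ge0 ?invr_ge0 ?(ltW r0)// seminorm_ge0.
(* The slack [e] makes [s] positive even where [p x = 0], and puts [s^-1 *: x] strictly inside the
   [p]-ball of radius [r]. *)
set s := _ + e; have s0 : 0 < s by rewrite ltr_wpDl.
have := pq (s^-1 *: x).
rewrite sp.2 sq.2 gtr0_norm ?invr_gt0// !ltr_pdivrMl// mulr1 => H.
by apply/ltW/H; rewrite -ltr_pdivrMr// mulrC /s ltrDl.
Qed.

(** Zorn's lemma for the reversed pointwise order. The pointwise infimum of a chain is finite
    because its members are at least [- p (- x)] at [x], and subadditive because the smaller of two
    members serves for both summands. *)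
Lemma minimal_sublinear (V W : lmodType R) (i : V -> W)
    (s : V -> R) (p : W -> R) :
  sublinear p -> (forall y, s y <= p (i y)) ->
  exists g : W -> R,
    [/\ sublinear g, forall x, g x <= p x, forall y, s y <= g (i y) &
     forall h : W -> R, sublinear h -> (forall x, h x <= g x) ->
       (forall y, s y <= h (i y)) -> h = g].
Proof.
move=> subp sp.
pose T := {g : W -> R | [/\ sublinear g, forall x, g x <= p x
                           & forall y, s y <= g (i y)]}.
pose Rel (g h : T) := `[< forall x, sval h x <= sval g x >].
pose p0 : T := exist _ p (And3 subp (fun x => lexx _) sp).
have [||//|A Atot|[g [sg gp gs]] gmin] := @Zorn T Rel.
- by move=> g; apply/asboolP.
- move=> g h k /asboolP gh /asboolP hk; apply/asboolP => x.
  exact: le_trans (hk x) (gh x).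
- move=> [g Pg] [h Ph] /asboolP /= gh /asboolP /= hg; apply: eq_exist.
  by apply/funext => x; apply/eqP; rewrite eq_le hg gh.
- have [A0|/set0P[a0 Aa0]] := eqVneq A set0.
    by exists p0 => t; rewrite A0.
  pose S x := [set sval a x | a in A].
  have low (a : T) x : - p (- x) <= sval a x.
    case: a => a [sa ap _] /=; have := sa.1 x (- x).
    by rewrite subrr (sublinear0 sa); have := ap (- x); lra.
  have infS x : has_inf (S x).
    split; first by exists (sval a0 x), a0.
    by exists (- p (- x)) => _ [a _ <-]; exact: low.
  pose m x := inf (S x).
  have mle a x : A a -> m x <= sval a x.
    by move=> Aa; apply: ge_inf; [exact: (infS x).2|exists a].
  have mge x c : (forall a, A a -> c <= sval a x) -> c <= m x.
    move=> cA; apply: lb_le_inf; first exact: (infS x).1.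
    by move=> _ [a Aa <-]; exact: cA.
  have subm : sublinear m.
    split=> [x y|t x].
      rewrite -lerBlDr; apply: (mge _ _) => a Aa; rewrite lerBlDr -lerBlDl.
      apply: (mge _ _) => b Ab; rewrite lerBlDl.
      have [c [Ac ca cb]] : exists c,
          [/\ A c, sval c x <= sval a x & sval c y <= sval b y].
        by have [/asboolP ab|/asboolP ba] := Atot _ _ Aa Ab; [exists b|exists a].
      apply: le_trans (mle c _ Ac) _.
      by case: (svalP c) => -[cD _] _ _; apply: le_trans (cD x y) _; lra.
    rewrite le_eqVlt => /predU1P[<-|t0].
      rewrite scale0r mul0r; apply/eqP; rewrite eq_le; apply/andP; split.
        by rewrite (le_trans (mle a0 _ Aa0))//; case: (svalP a0) => /sublinear0->.
      by apply: (mge _ _) => a _; case: (svalP a) => /sublinear0->.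
    apply/eqP; rewrite eq_le; apply/andP; split.
      rewrite -ler_pdivrMl//; apply: (mge _ _) => a Aa; rewrite ler_pdivrMl//.
      by case: (svalP a) => -[_ aZ] _ _; rewrite -aZ ?(ltW t0)//; exact: (mle a _ Aa).
    apply: (mge _ _) => a Aa; case: (svalP a) => -[_ aZ] _ _.
    by rewrite aZ ?(ltW t0)// ler_pM2l//; exact: (mle a _ Aa).
  have mT : [/\ sublinear m, forall x, m x <= p x & forall y, s y <= m (i y)].
    split=> // [x|y].
      by apply: le_trans (mle _ _ Aa0) _; case: (svalP a0).
    by apply: (mge _ _) => a _; case: (svalP a).
  by exists (exist _ m mT) => a Aa; apply/asboolP => x /=; exact: (mle a _ Aa).
exists g; split=> // h sh hg hs.
have hT : [/\ sublinear h, forall x, h x <= p x & forall y, s y <= h (i y)].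
  by split=> // x; exact: le_trans (hg x) (gp x).
by have := gmin (exist _ h hT) (introT (asboolP _) hg) => -[].
Qed.

End Sublinear.

(** * Flat seminorms: restriction along a linear map and change of seminorm *)

Section Flat.
Context {R : realType}.

(** In dual terms, the set of linear functionals below [g] has a small slice: any two of them with
    values at least [g z - e * d] at [z] differ by at most [3 * e] on the [q]-unit ball. *)
Definition nearly_flat (V : lmodType R) (q g : V -> R) (e : R) : Prop :=
  exists z : V, exists2 d : R, 0 < d &
    forall h, q h <= 1 -> g (z + d *: h) + g (z - d *: h) - 2 * g z <= e * d.

Definition flat_seminorm (V : lmodType R) (q : V -> R) : Prop :=
  forall (s : V -> R) (L : R), sublinear s -> (forall x, s x <= L * q x) ->
    forall e, 0 < e -> nearly_flat q s e.

(* Otherwise [inf_{t >= 0} g (x - t z) + t c], the support function of the linear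
   functionals [l <= g] with [l z <= c], would contradict the minimality of [g]. *)
Lemma minimal_sublinear_tight (V W : lmodType R) (i : {linear V -> W})
    (s : V -> R) (g : W -> R) (z : W) (c : R) :
  sublinear s -> sublinear g ->
  (forall h : W -> R, sublinear h -> (forall x, h x <= g x) ->
     (forall y, s y <= h (i y)) -> h = g) ->
  c < g z -> exists y, exists2 t, 0 <= t & g (i y - t *: z) + t * c < s y.
Proof.
move=> ss sg gmin cgz.
apply: contrapT => Nex.
have N y t : 0 <= t -> s y <= g (i y - t *: z) + t * c.
  move=> t0; rewrite leNgt; apply/negP => H; apply: Nex; exists y, t => //.
(* This bound, from [y = 0] and [t = 1], keeps the infima defining [h] below finite. *)
have gzc : 0 <= g (- z) + c.
  by have := N 0 1 ler01; rewrite (sublinear0 ss) linear0 sub0r scale1r mul1r.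
have gNt t : 0 <= t -> g (- (t *: z)) = t * g (- z).
  by move=> t0; rewrite -scalerN sg.2.
pose S x := [set g (x - t *: z) + t * c | t in [set t | 0 <= t]].
have low x t : 0 <= t -> - g (- x) <= g (x - t *: z) + t * c.
  move=> t0; have := sg.1 (x - t *: z) (- x).
  rewrite addrAC subrr add0r gNt// => H.
  have : 0 <= t * (g (- z) + c) by rewrite mulr_ge0.
  by rewrite mulrDr; lra.
have infS x : has_inf (S x).
  split; first by exists (g (x - 0 *: z) + 0 * c), 0 => //=.
  by exists (- g (- x)) => _ [t t0 <-]; exact: low.
pose h x := inf (S x).
have hle x t : 0 <= t -> h x <= g (x - t *: z) + t * c.
  by move=> t0; apply: ge_inf; [exact: (infS x).2|exists t].
have hge x b : (forall t, 0 <= t -> b <= g (x - t *: z) + t * c) -> b <= h x.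
  move=> bA; apply: lb_le_inf; first exact: (infS x).1.
  by move=> _ [t t0 <-]; exact: bA.
have sh : sublinear h.
  split=> [x y|a x].
    rewrite -lerBlDr; apply: (hge _ _) => t t0; rewrite lerBlDr -lerBlDl.
    apply: (hge _ _) => u u0; rewrite lerBlDl.
    apply: (le_trans (hle _ (t + u) (addr_ge0 t0 u0))).
    have := sg.1 (x - t *: z) (y - u *: z).
    rewrite addrACA -opprD -scalerDl mulrDl; lra.
  rewrite le_eqVlt => /predU1P[<-|a0].
    rewrite scale0r mul0r; apply/eqP; rewrite eq_le; apply/andP; split.
      by have := hle 0 0 (lexx _); rewrite scale0r subr0 mul0r addr0 (sublinear0 sg).
    apply: (hge _ _) => t t0; have := low 0 t t0.
    by rewrite oppr0 (sublinear0 sg) oppr0.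
  apply/eqP; rewrite eq_le; apply/andP; split.
    rewrite -ler_pdivrMl//; apply: (hge _ _) => t t0; rewrite ler_pdivrMl//.
    have := hle (a *: x) (a * t) (mulr_ge0 (ltW a0) t0).
    by rewrite -scalerA -scalerBr sg.2 ?(ltW a0)// mulrDr mulrA.
  apply: (hge _ _) => t t0; rewrite -ler_pdivlMl//.
  have t'0 : 0 <= a^-1 * t by rewrite mulr_ge0// invr_ge0 ltW.
  have := hle x _ t'0.
  have -> : a *: x - t *: z = a *: (x - (a^-1 * t) *: z).
    by rewrite scalerBr scalerA mulrA divff ?gt_eqF// mul1r.
  rewrite sg.2 ?(ltW a0)// mulrDr mulrA mulVf ?gt_eqF// mul1r mulrA.
  by [].
have hg x : h x <= g x.
  by have := hle x 0 (lexx _); rewrite scale0r subr0 mul0r addr0.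
have hs y : s y <= h (i y) by apply: (hge _ _) => t; exact: N.
have := hle z 1 ler01; rewrite (gmin _ sh hg hs) scale1r subrr (sublinear0 sg).
by rewrite mul1r; lra.
Qed.

(** If a minimal [g] is nearly flat at [z] with scale [d], tightness for [c = g z - e * d] gives [y]
    and [t] such that [s] is nearly flat at [y] with scale [t * d]. Of the factor 3, one unit is the
    second difference of [g] at [z]; the gap between [g z] and [c] counts twice. *)
Lemma nearly_flat_restrict (V W : lmodType R) (i : {linear V -> W})
    (s : V -> R) (p q : W -> R) (e : R) :
  sublinear s -> sublinear p -> (forall y, s y <= p (i y)) -> 0 < e ->
  (forall g, sublinear g -> (forall x, g x <= p x) -> nearly_flat q g e) ->
  nearly_flat (fun y => q (i y)) s (3 * e).
Proof.
move=> ss sp sip e0 Hp.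
have [g [sg gp gs gmin]] := minimal_sublinear sp sip.
have [z [d d0 gz]] := Hp g sg gp.
have ed0 : 0 < e * d by rewrite mulr_gt0.
have cgz : g z - e * d < g z by lra.
have [y [t t0 yt]] := minimal_sublinear_tight ss sg gmin cgz.
have {t0}t0 : 0 < t.
  rewrite lt_neqAle t0 andbT; apply/eqP => t00; move: yt.
  by rewrite -t00 scale0r subr0 mul0r addr0; have := gs y; lra.
exists y, (t * d); first by rewrite mulr_gt0.
move=> h qh.
have key a : s (y + (t * d) *: (a *: h)) <=
    g (i y - t *: z) + t * g (z + d *: (a *: i h)).
  apply: le_trans (gs _) _; rewrite -(sg.2 _ _ (ltW t0)).
  apply: le_trans _ (sg.1 _ _).
  rewrite [t *: (z + _)]scalerDr addrA subrK !scalerA.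
  by rewrite linearD linearZ/=.
have := key 1; have := key (- 1); rewrite !scale1r !scaleN1r !scalerN.
have := gz (i h) qh; rewrite -(ler_pM2l t0); lra.
Qed.

(** Each [h] in the [q]-ball is [q]-close to some [k *: h'] with [h'] in the [p]-ball, and [s] is
    Lipschitz for [q]; so a step [d / k] along [h] may be replaced by a step [d] along [h']. *)
Lemma flat_dense_image (V : lmodType R) (p q : V -> R) (k : R) :
  seminorm q -> 0 < k ->
  (forall h, q h <= 1 -> forall eta, 0 < eta ->
     exists2 h', p h' <= 1 & q (h - k *: h') <= eta) ->
  (forall (s : V -> R) L, sublinear s -> (forall x, s x <= L * q x) ->
     forall e, 0 < e -> nearly_flat p s e) ->
  flat_seminorm q.
Proof.
move=> sq k0 pq H s L ss sL e e0.
have L'0 : 0 <= `|L| by [].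
have sL' x : s x <= `|L| * q x.
  by apply: le_trans (sL x) _; rewrite ler_wpM2r ?seminorm_ge0// ler_norm.
(* Half of [e] is for the second difference along [h']; [eta] below spends a quarter on each of the
   two replacements. *)
have e'0 : 0 < e / (2 * k) by rewrite divr_gt0// mulr_gt0.
have [z [d d0 zd]] := H s L ss sL _ e'0.
exists z, (d / k); first by rewrite divr_gt0.
move=> h qh.
pose eta := e / (4 * (`|L| + 1)).
have L1 : 0 < `|L| + 1 by rewrite ltr_wpDl.
have eta0 : 0 < eta by rewrite divr_gt0 ?mulr_gt0.
have [h' ph' qh'] := pq h qh eta eta0.
have dk0 : 0 <= d / k by rewrite divr_ge0 ?ltW.
have key a : `|a| = 1 -> s (z + (d / k) *: (a *: h)) <=
    s (z + d *: (a *: h')) + (d / k) * (e / 4).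
  move=> a1.
  have -> : z + (d / k) *: (a *: h) =
      (z + d *: (a *: h')) + (d / k) *: (a *: (h - k *: h')).
    rewrite -addrA; congr (_ + _); rewrite [a *: (_ - _)]scalerBr scalerBr.
    rewrite !scalerA.
    have -> : d / k * a * k = d * a by field; rewrite gt_eqF.
    by rewrite addrC subrK.
  apply: le_trans (ss.1 _ _) _; rewrite lerD2l ss.2// ler_wpM2l//.
  apply: le_trans (sL' _) _; rewrite sq.2 a1 mul1r.
  apply: (@le_trans _ _ (`|L| * eta)); first by rewrite ler_wpM2l.
  rewrite /eta mulrA ler_pdivrMr ?mulr_gt0//.
  nra.
have := key 1 (normr1 _); have := key (-1) (normrN1 _).
rewrite !scale1r !scaleN1r !scalerN; have := zd h' ph'.
have -> : d / k * (e / 4) = e * (d / k) / 4 by ring.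
have -> : e / (2 * k) * d = e * (d / k) / 2 by field; rewrite gt_eqF.
lra.
Qed.

End Flat.

(** * Baire's theorem and open mappings *)

Section OpenMapping.
Context {R : realType}.

(** By Baire's theorem the closure of the image of some [p]-ball contains a ball about a point [y0];
    differences of image points near [y0 + (r / 2) *: y] and [y0 - (r / 2) *: y] move it to the
    origin. A seminorm [p] is used so that the lemma also serves for a subspace of [E]. *)
Lemma almost_open (V : lmodType R) (Y : completeNormedModType R)
    (p : V -> R) (T : {linear V -> Y}) :
  seminorm p -> (forall y, exists x, T x = y) ->
  exists2 k, 0 < k & forall y, `|y| <= 1 -> forall eta, 0 < eta ->
    exists2 x, p x <= k & `|T x - y| <= eta.
Proof.
move=> sp surjT.
pose C n := closure (T @` [set x | p x <= n%:R]).
have [n nd] : exists n, ~ dense (~` C n).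
  apply/existsNP => dC.
  have /Baire : forall n, open (~` C n) /\ dense (~` C n).
    by move=> n; split=> //; rewrite openC; exact: closed_closure.
  move=> /(_ setT) [||y [_ yC]]; [by exists 0|exact: openT|].
  have [x xy] := surjT y.
  have [n pn] : exists n, p x <= n%:R.
    exists (Num.trunc (p x)).+1; exact/ltW/truncnS_gt.
  by apply: (yC n) => //; apply: subset_closure; exists x.
move: nd => /denseNE[U [[y0 [Uo Uy0]]]] UC.
have {UC}UC : U `<=` C n.
  by move=> y Uy; apply: contrapT => yC; rewrite -[False]/(set0 y) -UC.
have [/= r r0 rU] : nbhs_ball y0 U by rewrite nbhs_ballE; exact: open_nbhs_nbhs.
(* The preimage will be [r^-1 *: (a - b)] with [p a] and [p b] at most [n]; adding 1 keeps [k]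
   positive when [n = 0]. *)
pose k := 2 * n%:R / r + 1.
exists k; first by rewrite ltr_wpDl// divr_ge0 ?(ltW r0)// mulr_ge0.
move=> y y1 eta eta0.
have near a : `|a| = 1 -> exists2 x, p x <= n%:R &
    `|T x - (y0 + a * (r / 2) *: y)| < eta * r / 2.
  move=> a1.
  have : C n (y0 + a * (r / 2) *: y).
    apply/UC/rU; rewrite -ball_normE/= opprD addNKr normrN normrZ normrM a1 mul1r.
    rewrite gtr0_norm ?divr_gt0//.
    by rewrite (@le_lt_trans _ _ (r / 2)) ?ler_piMr ?divr_ge0 ?(ltW r0)//; lra.
  have er0 : 0 < eta * r / 2 by rewrite divr_gt0// mulr_gt0.
  move=> /(_ (ball _ _) (nbhsx_ballx _ _ er0)) [_ [[x px <-]]].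
  by rewrite -ball_normE/= distrC; exists x.
have [a pa] := near 1 (normr1 _); rewrite mul1r => Ta.
have [b pb] := near (-1) (normrN1 _); rewrite mulN1r scaleNr => Tb.
exists (r^-1 *: (a - b)).
  rewrite sp.2 ger0_norm ?invr_ge0 ?(ltW r0)// ler_pdivrMl//.
  rewrite /k mulrDr mulrA mulrAC divff ?gt_eqF// mul1r mulr1.
  by have := seminormB sp a b; move: r0 => /=; lra.
have -> : T (r^-1 *: (a - b)) - y =
    r^-1 *: ((T a - (y0 + (r / 2) *: y)) - (T b - (y0 - (r / 2) *: y))).
  rewrite linearZ/= linearB/=.
  have -> : T a - (y0 + (r / 2) *: y) - (T b - (y0 - (r / 2) *: y)) =
    (T a - T b) - r *: y.
    rewrite opprB [(y0 - _) - _]addrC addrACA opprD [X in _ + X]addrACA addNr add0r.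
    rewrite -opprD -scalerDl.
    by have -> : r / 2 + r / 2 = r by field.
  by rewrite [RHS]scalerBr scalerA mulVf ?gt_eqF// scale1r.
rewrite normrZ gtr0_norm ?invr_gt0// ler_pdivrMl//.
by apply: le_trans (ler_normB _ _) _; move: Ta Tb; lra.
Qed.

(* The almost-open bound is improved to an exact one by successive
   approximation along a geometric series. *)
Lemma open_mapping (X Y : completeNormedModType R) (T : {linear X -> Y}) :
  continuous T -> (forall y, exists x, T x = y) ->
  exists2 k, 0 < k & forall y, exists2 x, T x = y & `|x| <= k * `|y|.
Proof.
move=> cT surjT.
have [k k0 kT] := almost_open (@seminorm_norm _ X X idfun) surjT.
have /choice[phi phiP] : forall y, exists x,
    `|x| <= k * `|y| /\ `|y - T x| <= `|y| / 2.
  move=> y; have [->|y0] := eqVneq y 0.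
    by exists 0; rewrite linear0 subr0 !normr0 mulr0 mul0r.
  have ny : 0 < `|y| by rewrite normr_gt0.
  have y1 : `| `|y|^-1 *: y| <= 1.
    by rewrite normrZ normfV normr_id mulVf ?gt_eqF.
  have [|x xk Tx] := kT _ y1 (2^-1); first by rewrite invr_gt0.
  exists (`|y| *: x); rewrite normrZ normr_id mulrC; split.
    by rewrite ler_wpM2r.
  have -> : y - T (`|y| *: x) = - (`|y| *: (T x - `|y|^-1 *: y)).
    by rewrite linearZ/= scalerBr scalerA divff ?gt_eqF// scale1r opprB.
  by rewrite normrN normrZ normr_id ler_wpM2l.
exists (2 * k); first by rewrite mulr_gt0.
move=> y.
(* [r n] is the error left after [n] corrections, at most half of the preceding one; the preimage of
   [y] is the sum of the corrections [phi (r n)]. *)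
pose r := fix r n := if n is m.+1 then r m - T (phi (r m)) else y.
have rn n : `|r n| <= `|y| * 2^-1 ^+ n.
  elim: n => [|n IH]; first by rewrite expr0 mulr1.
  apply: le_trans (phiP (r n)).2 _.
  by rewrite exprSr mulrA ler_wpM2r// invr_ge0.
pose u n := phi (r n).
have un n : `|u n| <= geometric (k * `|y|) 2^-1 n.
  apply: le_trans (phiP _).1 _.
  by rewrite /geometric/= -mulrA ler_pM2l.
have half1 : `|2^-1 : R| < 1 by rewrite ger0_norm ?invr_ge0// invf_lt1// ltr1n.
have cg := @is_cvg_geometric_series R (k * `|y|) _ half1.
have cnu : cvgn [normed series u].
  apply: series_le_cvg cg => [n|n|//]; first exact: normr_ge0.
  rewrite /geometric/=; apply: mulr_ge0; last exact: exprn_ge0.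
  by rewrite mulr_ge0 ?(ltW k0).
have cu := normed_cvg cnu.
exists (limn (series u)).
  have Tu n : T (series u n) = y - r n.
    elim: n => [|n IH]; first by rewrite seriesEnat /= big_geq// linear0 subrr.
    rewrite seriesEnat/= big_nat_recr//= linearD/= -/(series u n) IH.
    by rewrite opprB addrA addrAC.
  have : T (series u n) @[n --> \oo] --> T (limn (series u)).
    by apply: continuous_cvg => //; exact: cT.
  move=> /cvg_lim <- //.
  apply/cvg_lim => //.
  rewrite (_ : (fun n => _) = (fun n => y - r n)); last exact/funext.
  rewrite -[X in _ --> X]subr0; apply: cvgB; first exact: cvg_cst.
  apply/norm_cvg0P.
  apply: (@squeeze_cvgr _ _ _ _ (fun=> 0) (fun n => `|y| * 2^-1 ^+ n)).
  - by near=> n; rewrite normr_ge0 rn.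
  - exact: cvg_cst.
  - rewrite -[X in _ --> X](mulr0 `|y|); apply: cvgM; first exact: cvg_cst.
    exact: cvg_expr.
apply: le_trans (lim_series_norm cnu) _.
apply: le_trans (lim_series_le cnu cg un) _.
have /cvg_lim -> := @cvg_geometric_series R (k * `|y|) _ half1; last by [].
have -> : (1 - 2^-1)^-1 = 2 :> R by field.
by rewrite mulrC mulrA.
Unshelve. all: by end_near. Qed.

End OpenMapping.

(** * Local bounds for convex functions in terms of one seminorm *)

Section ConvexSeminorm.
Context {R : realType} {V : lmodType R}.
Variables (D : set V) (f q : V -> R).
Hypothesis sq : seminorm q.
Hypothesis convD : forall x y (l : R), D x -> D y -> 0 <= l -> l <= 1 ->
  D (l *: x + (1 - l) *: y).
Hypothesis convf : forall x y (l : R), D x -> D y -> 0 <= l -> l <= 1 ->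
  f (l *: x + (1 - l) *: y) <= l * f x + (1 - l) * f y.

Lemma conv_translate (u a b : V) (l : R) :
  l *: (u + a) + (1 - l) *: (u + b) = u + (l *: a + (1 - l) *: b).
Proof. by rewrite !scalerDr addrACA -scalerDl subrKC scale1r. Qed.

(** Prolong the segment from [x1] to [u] up to [w] in [D]: then [u = l *: x1 + (1 - l) *: w], and
    the homothety of centre [w] and ratio [l] carries the [q]-ball about [x1] to one about [u]. *)
Lemma convex_locally_bounded x1 r M :
  0 < r -> (forall y, q (y - x1) < r -> D y /\ f y <= M) ->
  forall u, D u -> (exists2 t, 0 < t & D (u + t *: (u - x1))) ->
  exists2 r', 0 < r' & exists M', forall y, q (y - u) < r' -> D y /\ f y <= M'.
Proof.
move=> r0 x1M u Du [t t0 Dw]; set w := u + _ in Dw.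
pose l := t / (1 + t).
have t1 : 0 < 1 + t by rewrite ltr_wpDl.
have l0 : 0 < l by rewrite divr_gt0.
have l1 : l <= 1 by rewrite ler_pdivrMr// mul1r lerDr.
exists (l * r); first by rewrite mulr_gt0.
exists (l * M + (1 - l) * f w) => y yu.
pose y' := x1 + l^-1 *: (y - u).
have [|Dy' fy'] := x1M y'.
  by rewrite addrC addKr sq.2 gtr0_norm ?invr_gt0// mulrC ltr_pdivrMr// mulrC.
have yE : y = l *: y' + (1 - l) *: w.
  have -> : y' = u + ((x1 - u) + l^-1 *: (y - u)) by rewrite addrA subrKC.
  rewrite /w -(opprB x1 u) conv_translate scalerDr !scalerN !scalerA.
  rewrite divff ?gt_eqF// scale1r.
  have -> : (1 - l) * t = l by rewrite /l; field; rewrite gt_eqF.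
  by rewrite addrAC subrr add0r subrKC.
rewrite yE; split; first exact: convD Dy' Dw (ltW l0) l1.
apply: le_trans (convf Dy' Dw (ltW l0) l1) _.
by rewrite lerD2r ler_pM2l.
Qed.

Lemma convex_locally_lipschitz u r M :
  0 < r -> (forall y, q (y - u) < r -> D y /\ f y <= M) ->
  exists2 L, 0 <= L & forall x y, q (x - u) < r / 2 -> q (y - u) < r / 2 ->
    f x - f y <= L * q (x - y).
Proof.
move=> r0 uM.
have half (x : V) : 2^-1 *: x + (1 - 2^-1) *: x = x.
  by rewrite -scalerDl subrKC scale1r.
(* Reflect [y] in [u]: by convexity the upper bound at the reflected point becomes a lower bound at
   [y]. *)
have low y : q (y - u) < r -> 2 * f u - M <= f y.
  move=> yu; have [Dy _] := uM _ yu.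
  have [|Dy' fy'] := uM (u - (y - u)); first by rewrite addrAC subrr add0r seminormN.
  have := convf Dy Dy' (_ : 0 <= 2^-1) (_ : 2^-1 <= 1).
  rewrite invr_ge0 ler0n invf_le1// ler1n => /(_ isT isT).
  rewrite -{1}(subrKC u y) conv_translate.
  have -> : (1 - 2^-1) = 2^-1 :> R by field.
  by rewrite -scalerDr subrr scaler0 addr0; lra.
have Mu : f u <= M by apply: (uM u _).2; rewrite subrr (seminorm0 sq).
exists (4 * (M - f u) / r).
  by rewrite divr_ge0 ?(ltW r0)// mulr_ge0// subr_ge0.
move=> x y xu yu.
have qxy := seminorm_ge0 sq (x - y).
have [Dy _] : D y /\ f y <= M by apply: uM; lra.
(* Prolong the chord from [y] to [x] beyond [x] and compare slopes. The number [s] stands in for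
   [q (x - y)], which may vanish. *)
have key s : q (x - y) < s -> f x - f y <= 4 * (M - f u) / r * s.
  move=> qs; have s0 : 0 < s by apply: le_lt_trans qs.
  have [|Dz fz] := uM (x + (r / (2 * s)) *: (x - y)).
    rewrite addrAC; apply: le_lt_trans (sq.1 _ _) _.
    have c0 : 0 < r / (2 * s) by rewrite divr_gt0 ?mulr_gt0.
    have : q ((r / (2 * s)) *: (x - y)) < r / 2.
      rewrite sq.2 gtr0_norm//.
      have -> : r / 2 = r / (2 * s) * s by field; rewrite gt_eqF.
      by rewrite ltr_pM2l.
    by lra.
  pose l := 2 * s / (2 * s + r).
  have sr : 0 < 2 * s + r by rewrite addr_gt0 ?mulr_gt0.
  have l0 : 0 <= l by rewrite divr_ge0 ?(ltW sr)// mulr_ge0 ?ltW.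
  have l1 : l <= 1 by rewrite ler_pdivrMr// mul1r; lra.
  have := convf Dz Dy l0 l1.
  have -> : l *: (x + r / (2 * s) *: (x - y)) + (1 - l) *: y = x.
    rewrite -[X in _ + (1 - l) *: X](addr0 y) -{1}(subrKC y x) -addrA.
    rewrite conv_translate scaler0 addr0 -{1}(scale1r (x - y)) -scalerDl scalerA.
    have -> : l * (1 + r / (2 * s)) = 1 by rewrite /l; field; rewrite !gt_eqF.
    by rewrite scale1r subrKC.
  have fy := low y.
  have : 0 <= M - f u by rewrite subr_ge0.
  have {fy}fy : 2 * f u - M <= f y by apply: fy; lra.
  have : l <= 2 * s / r.
    rewrite /l ler_pM2l ?mulr_gt0// lef_pV2 ?posrE//; lra.
  move=> lr Mf H.
  have : l * (f (x + r / (2 * s) *: (x - y)) - f y) <= 2 * s / r * (2 * (M - f u)).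
    apply: le_trans (_ : l * (2 * (M - f u)) <= _).
      by rewrite ler_wpM2l//; lra.
    by rewrite ler_wpM2r// mulr_ge0.
  have -> : 4 * (M - f u) / r * s = 2 * s / r * (2 * (M - f u)) by ring.
  lra.
apply/ler_addgt0Pr => e e0.
pose c := 4 * (M - f u) / r.
have c0 : 0 <= c by rewrite divr_ge0 ?(ltW r0)// mulr_ge0// subr_ge0.
have c1 : 0 < c + 1 by rewrite ltr_wpDl.
apply: le_trans (key (q (x - y) + e / (c + 1)) _) _.
  by rewrite ltrDl divr_gt0.
rewrite -/c mulrDr lerD2l mulrA ler_pdivrMr// mulrC ler_pM2l//; lra.
Qed.

Hypothesis lipf : forall u, D u -> exists r L : R, [/\ 0 < r, 0 <= L,
  forall y, q (y - u) < r -> D y &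
  forall x y, q (x - u) < r -> q (y - u) < r -> f x - f y <= L * q (x - y)].

(** The threshold [rho] is common to a whole [q]-ball about [u], which makes this an open condition
    for [q], as Baire's theorem will require. *)
Definition smooth_near (e : R) (u : V) : Prop :=
  exists2 r, 0 < r & exists2 rho, 0 < rho & forall v, q (v - u) < r ->
    D v /\ forall t h, 0 < t -> t < rho -> q h <= 1 ->
      f (v + t *: h) + f (v - t *: h) - 2 * f v <= e * t.

Lemma smooth_near_le e e' u :
  e <= e' -> smooth_near e u -> smooth_near e' u.
Proof.
move=> ee [r r0 [rho rho0 H]]; exists r => //; exists rho => // v vu.
have [Dv vP] := H v vu; split=> // t h t0 trho qh.
by apply: le_trans (vP t h t0 trho qh) _; rewrite ler_pM2r.
Qed.

Lemma smooth_near_open e u : smooth_near e u ->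
  exists2 r, 0 < r & forall v, q (v - u) < r -> smooth_near e v.
Proof.
move=> [r r0 [rho rho0 uP]]; exists (r / 2); first by rewrite divr_gt0.
move=> v vu; exists (r / 2); first by rewrite divr_gt0.
exists rho => // w wv; apply: uP.
by have := sq.1 (w - v) (v - u); rewrite addrA subrK; lra.
Qed.

(** * Slopes of chords near a point *)

Section DifferenceQuotients.
Variables (x0 : V) (r L : R).
Hypotheses (r0 : 0 < r) (L0 : 0 <= L).
Let U x := q (x - x0) < r.
Hypothesis UD : forall x, U x -> D x.
Hypothesis lipU : forall x y, U x -> U y -> f x - f y <= L * q (x - y).

Let quotients y := [set c | exists x s, [/\ 0 < s, U x, U (x + s *: y) &
  c = (f (x + s *: y) - f x) / s]].

(* The support function of the set of subgradients of [f] at points of [U]. *)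
Definition sup_slope y := sup (quotients y).

Let Uconv a b l : U a -> U b -> 0 <= l -> l <= 1 -> U (l *: a + (1 - l) *: b).
Proof.
move=> Ua Ub l0 l1; rewrite /U.
have -> : l *: a + (1 - l) *: b - x0 = l *: (a - x0) + (1 - l) *: (b - x0).
  by rewrite -[in LHS](subrKC x0 a) -[in LHS](subrKC x0 b) conv_translate addrC addKr.
apply: le_lt_trans (sq.1 _ _) _.
rewrite !sq.2 !ger0_norm ?subr_ge0//.
move: Ua Ub; rewrite /U => Ua Ub.
have [->|ln0] := eqVneq l 0; first by rewrite mul0r subr0 add0r mul1r.
have {}l0 : 0 < l by rewrite lt_neqAle eq_sym ln0.
have : l * q (a - x0) < l * r by rewrite ltr_pM2l.
have : (1 - l) * q (b - x0) <= (1 - l) * r by rewrite ler_wpM2l ?subr_ge0// ltW.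
lra.
Qed.

Let Ux0 : U x0.
Proof. by rewrite /U subrr (seminorm0 sq). Qed.

Let small x y : U x ->
  exists2 t, 0 < t & forall s, 0 <= s -> s <= t -> U (x + s *: y).
Proof.
move=> Ux; have y1 : 0 < q y + 1 by rewrite ltr_wpDl// seminorm_ge0.
exists ((r - q (x - x0)) / 2 / (q y + 1)).
  by rewrite !divr_gt0// subr_gt0.
move=> s s0; rewrite ler_pdivlMr// /U addrAC => sy.
apply: le_lt_trans (sq.1 _ _) _; rewrite sq.2 ger0_norm//.
by move: Ux; rewrite /U; lra.
Qed.

Let has_sup_quotients y : has_sup (quotients y).
Proof.
split.
  have [t t0 tP] := small y Ux0.
  exists ((f (x0 + t *: y) - f x0) / t), x0, t; split=> //.
  by apply: tP => //; exact: ltW.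
exists (L * q y) => _ [x [s [s0 Ux Us ->]]].
rewrite ler_pdivrMr//; apply: le_trans (lipU Us Ux) _.
by rewrite addrC addKr sq.2 gtr0_norm// mulrCA mulrC.
Qed.

Lemma sup_slope_ub x s y : U x -> 0 < s -> U (x + s *: y) ->
  f (x + s *: y) - f x <= s * sup_slope y.
Proof.
move=> Ux s0 Us; rewrite mulrC -ler_pdivrMr//.
by apply: ub_le_sup; [exact: (has_sup_quotients y).2|exists x, s].
Qed.

Lemma sup_slope_lub c y :
  (forall x s, U x -> 0 < s -> U (x + s *: y) -> f (x + s *: y) - f x <= s * c) ->
  sup_slope y <= c.
Proof.
move=> cP; apply: ge_sup; first exact: (has_sup_quotients y).1.
by move=> _ [x [s [s0 Ux Us ->]]]; rewrite ler_pdivrMr// mulrC; exact: cP.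
Qed.

Lemma sup_slope_le y : sup_slope y <= L * q y.
Proof.
apply: sup_slope_lub => x s Ux s0 Us; apply: le_trans (lipU Us Ux) _.
by rewrite addrC addKr sq.2 gtr0_norm// mulrCA.
Qed.

(** Slopes increase along a line, so the final piece of a chord is at least as steep as the
    chord. *)
Lemma chord_backward e y s k : U e -> U (e - s *: y) -> 0 < s -> 0 <= k -> k <= s ->
  U (e - k *: y) /\ k / s * (f e - f (e - s *: y)) <= f e - f (e - k *: y).
Proof.
move=> Ue Us s0 k0 ks.
have l0 : 0 <= k / s by rewrite divr_ge0 ?(ltW s0).
have l1 : k / s <= 1 by rewrite ler_pdivrMr// mul1r.
have E : e - k *: y = (k / s) *: (e - s *: y) + (1 - k / s) *: e.
  rewrite -[X in _ + (_ - _) *: X]addr0 conv_translate scaler0 addr0 scalerN scalerA.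
  by rewrite mulfVK ?gt_eqF.
rewrite E; split; first exact: Uconv.
by have := convf (UD Us) (UD Ue) l0 l1; lra.
Qed.

(** For subadditivity, the detour through [x + s *: y1] might leave the ball [U]. A short final
    piece of the chord is used instead: it is at least as steep, and its detour through
    [e - k *: y2] stays in [U]. *)
Lemma sup_slope_sublinear : sublinear sup_slope.
Proof.
split=> [y1 y2|c y].
  apply: sup_slope_lub => x s Ux s0; set e := x + _ => Ue.
  have [t t0 tP] := small (- y2) Ue.
  pose k := Num.min s t.
  have k0 : 0 < k by rewrite /k lt_min s0.
  have ks : k <= s by rewrite /k ge_min lexx.
  have kt : k <= t by rewrite /k ge_min lexx orbT.
  have xE : x = e - s *: (y1 + y2) by rewrite /e addrK.
  have Ue2 : U (e - k *: y2) by rewrite -scalerN; apply: tP => //; exact: ltW.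
  have Ues : U (e - s *: (y1 + y2)) by rewrite -xE.
  have [Uw] := chord_backward Ue Ues s0 (ltW k0) ks; rewrite -xE.
  have wE : e - k *: (y1 + y2) + k *: y1 = e - k *: y2.
    by rewrite scalerDr opprD addrA addrAC subrK.
  have := sup_slope_ub Uw k0 (y := y1); rewrite wE => /(_ Ue2).
  have := sup_slope_ub Ue2 k0 (y := y2); rewrite subrK => /(_ Ue).
  move=> H1 H2 H3.
  have : k / s * (f e - f x) <= k * (sup_slope y1 + sup_slope y2) by lra.
  by rewrite -mulrA ler_pM2l// mulrC ler_pdivrMr// mulrC.
have Hc y' c' : 0 < c' -> sup_slope (c' *: y') <= c' * sup_slope y'.
  move=> c0; apply: sup_slope_lub => x s Ux s0; rewrite scalerA => Us.
  by rewrite mulrA; apply: sup_slope_ub => //; rewrite mulr_gt0.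
rewrite le_eqVlt => /predU1P[<-|c0].
  rewrite scale0r mul0r; apply/eqP; rewrite eq_le; apply/andP; split.
    by apply: sup_slope_lub => x s _ _ _; rewrite scaler0 addr0 subrr mulr0.
  have := sup_slope_ub Ux0 ltr01 (y := 0); rewrite scaler0 addr0 subrr mul1r.
  exact.
apply/eqP; rewrite eq_le Hc//= -ler_pdivlMl//.
have := Hc (c *: y) c^-1; rewrite scalerA mulVf ?gt_eqF// scale1r; apply.
by rewrite invr_gt0.
Qed.

(** A chord from [x] to [u] almost attains [sup_slope y]. For [v] near [u] the chord ending at [v]
    still does, and so does its final piece from [v - k *: y]; from there [v + t *: h] and
    [v - t *: h] are reached in directions close to [y], where flatness bounds the slopes. In units
    of [e / 5] the losses are 1 from flatness and 2 for each sign. *)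
Lemma sup_slope_smooth e : 0 < e -> nearly_flat q sup_slope (e / 5) ->
  exists2 u, U u & smooth_near e u.
Proof.
move=> e0 [y [d d0 yd]].
have ed0 : 0 < e / 5 * d by rewrite mulr_gt0// divr_gt0.
have [x [s [Ux s0 Us fs]]] : exists x s, [/\ U x, 0 < s, U (x + s *: y) &
    s * (sup_slope y - e / 5 * d) < f (x + s *: y) - f x].
  apply: contrapT => H.
  have : sup_slope y <= sup_slope y - e / 5 * d.
    apply: sup_slope_lub => x s Ux s0 Us; rewrite leNgt; apply/negP => H'.
    by apply: H; exists x, s.
  lra.
set u := x + s *: y in Us fs; exists u => //.
pose g := Num.min (r - q (u - x0)) (r - q (x - x0)).
have g0 : 0 < g by move: Us Ux; rewrite /U /g lt_min !subr_gt0 => -> ->.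
have gu : g <= r - q (u - x0) by rewrite /g ge_min lexx.
have gx : g <= r - q (x - x0) by rewrite /g ge_min lexx orbT.
pose c := s * (e / 5 * d).
have c0 : 0 < c by rewrite mulr_gt0.
have L1 : 0 < 2 * L + 1 by rewrite ltr_wpDl// mulr_ge0.
(* The first bound keeps [v] and [v - s *: y] in [U]; the second keeps the Lipschitz loss
   [2 * L * q (v - u)] below [c]. *)
exists (Num.min (g / 2) (c / (2 * L + 1))).
  by rewrite lt_min !divr_gt0.
exists (Num.min (s * d) (g / 2)).
  by rewrite lt_min mulr_gt0// divr_gt0.
move=> v; rewrite lt_min => /andP[vg]; rewrite ltr_pdivlMr// => vc.
have qvu := seminorm_ge0 sq (v - u).
have Uv : U v by have := sq.1 (v - u) (u - x0); rewrite addrA subrK /U; lra.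
have vsx : v - s *: y - x = v - u by rewrite /u opprD addrA addrAC.
have Uvs : U (v - s *: y).
  by have := sq.1 (v - s *: y - x) (x - x0); rewrite vsx -{1}vsx addrA subrK /U; lra.
split; first exact: UD.
move=> t h t0; rewrite lt_min => /andP[tsd tg] qh.
pose k := t / d.
have k0 : 0 < k by rewrite divr_gt0.
have ks : k <= s by rewrite ler_pdivrMr// ltW.
have [Uk fk] := chord_backward Uv Uvs s0 (ltW k0) ks.
have kd : k * d = t by rewrite /k mulfVK ?gt_eqF.
have Ut a : `|a| = 1 -> U (v + t *: (a *: h)).
  move=> a1; rewrite /U; have := sq.1 (v - u) (u - x0).
  have := sq.1 (v - x0) (t *: (a *: h)).
  rewrite !sq.2 a1 mul1r gtr0_norm// addrA subrK addrAC.
  have : t * q h <= t by rewrite ler_piMr ?(ltW t0).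
  lra.
have step a : `|a| = 1 ->
    f (v + t *: (a *: h)) - f (v - k *: y) <= k * sup_slope (y + d *: (a *: h)).
  move=> a1.
  have E : v + t *: (a *: h) = v - k *: y + k *: (y + d *: (a *: h)).
    by rewrite scalerDr addrA subrK [k *: (_ *: _)]scalerA kd.
  by have := Ut _ a1; rewrite E => U'; exact: sup_slope_ub.
have := step 1 (normr1 _); have := step (-1) (normrN1 _).
rewrite !scale1r !scaleN1r !scalerN => H1 H2.
have Hfl : k * (sup_slope (y + d *: h) + sup_slope (y - d *: h) - 2 * sup_slope y)
    <= k * (e / 5 * d) by rewrite ler_pM2l// yd.
have fu : f u - f v <= L * q (v - u).
  by rewrite (seminorm_distC sq v); exact: lipU.
have fx : f (v - s *: y) - f x <= L * q (v - u) by rewrite -vsx; exact: lipU.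
have Hb : s * (sup_slope y - 2 * (e / 5 * d)) <= f v - f (v - s *: y).
  have : 2 * L * q (v - u) <= c by lra.
  by rewrite /c; lra.
have : k * (sup_slope y - 2 * (e / 5 * d)) <= f v - f (v - k *: y).
  apply: le_trans fk; rewrite -(mulrA k) ler_pM2l// ler_pdivlMl//.
have -> : e * t = 5 * (k * (e / 5 * d)) by rewrite -kd; field.
lra.
Qed.

End DifferenceQuotients.

Lemma smooth_near_dense : flat_seminorm q -> forall x0 r e,
  D x0 -> 0 < r -> 0 < e -> exists2 u, q (u - x0) < r & smooth_near e u.
Proof.
move=> flatq x0 r e Dx0 r0 e0.
have [r1 [L [r10 L0 r1D lip]]] := lipf Dx0.
have m0 : 0 < Num.min r r1 by rewrite lt_min r0.
have mD x : q (x - x0) < Num.min r r1 -> D x by rewrite lt_min => /andP[_ /r1D].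
have mlip x y : q (x - x0) < Num.min r r1 -> q (y - x0) < Num.min r r1 ->
    f x - f y <= L * q (x - y).
  by rewrite !lt_min => /andP[_ ?] /andP[_ ?]; exact: lip.
have e5 : 0 < e / 5 by rewrite divr_gt0.
have [|u + us] := sup_slope_smooth m0 L0 mD mlip e0.
  apply: flatq e5; first exact: sup_slope_sublinear m0 mD mlip.
  exact: sup_slope_le m0 mlip.
by rewrite lt_min => /andP[ur _]; exists u.
Qed.

(** * Differentiability from small second differences *)

Lemma chord_forward x h s k : D x -> D (x + s *: h) -> 0 < s -> 0 <= k -> k <= s ->
  f (x + k *: h) - f x <= k * ((f (x + s *: h) - f x) / s).
Proof.
move=> Dx Ds s0 k0 ks.
have l0 : 0 <= k / s by rewrite divr_ge0 ?(ltW s0).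
have l1 : k / s <= 1 by rewrite ler_pdivrMr// mul1r.
have := convf Ds Dx l0 l1.
rewrite -[X in _ + (_ - _) *: X]addr0 conv_translate scaler0 addr0 scalerA.
rewrite mulfVK ?gt_eqF//; lra.
Qed.

(** The infimum [d h] of the difference quotients is the one-sided derivative, sublinear by
    convexity. Small second differences force [d (- h) = - d h], hence linearity, and then bound the
    quotients for small [t > 0] by [d h + e]. *)
Lemma smooth_differentiable x : D x -> (forall e, 0 < e -> smooth_near e x) ->
  exists df : {linear V -> R^o}, (exists L, forall h, `|df h| <= L * q h) /\
    forall e, 0 < e -> exists2 rho, 0 < rho & forall t h, t != 0 -> `|t| < rho ->
      q h <= 1 -> `|(f (x + t *: h) - f x) / t - df h| <= e.
Proof.
move=> Dx smx; have [r [L [r0 L0 rD lip]]] := lipf Dx.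
pose good h t := 0 < t /\ t * q h < r.
have qxt t h : 0 < t -> q (x + t *: h - x) = t * q h.
  by move=> t0; rewrite addrC addKr sq.2 gtr0_norm.
have Ux : q (x - x) < r by rewrite subrr (seminorm0 sq).
have goodD h t : good h t -> D (x + t *: h).
  by move=> [t0 tr]; apply: rD; rewrite qxt.
have good_small h t s : good h t -> 0 < s -> s <= t -> good h s.
  move=> [t0 tr] s0 st; split=> //; apply: le_lt_trans tr.
  by rewrite ler_wpM2r// seminorm_ge0.
have [gt gtP] : exists gt, forall h, good h (gt h).
  have /choice[gt gtP] : forall h, exists t, good h t; last by exists gt.
  move=> h; have q1 : 0 < q h + 1 by rewrite ltr_wpDl// seminorm_ge0.
  exists (r / (q h + 1)); split; first by rewrite divr_gt0.
  by rewrite mulrAC ltr_pdivrMr// ltr_pM2l// ltrDl.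
have low h t : good h t -> - (L * q h) <= (f (x + t *: h) - f x) / t.
  move=> [t0 tr]; rewrite ler_pdivlMr// mulNr lerNl opprB.
  apply: le_trans (lip _ _ Ux _) _; first by rewrite qxt.
  by rewrite (seminorm_distC sq) qxt// mulrCA mulrC.
pose S h := [set (f (x + t *: h) - f x) / t | t in good h].
have infS h : has_inf (S h).
  split; first by exists ((f (x + gt h *: h) - f x) / gt h), (gt h).
  by exists (- (L * q h)) => _ [t tg <-]; exact: low.
pose d h := inf (S h).
have dle h t : good h t -> t * d h <= f (x + t *: h) - f x.
  move=> ht; have [t0 _] := ht; rewrite mulrC -ler_pdivlMr//.
  by apply: ge_inf; [exact: (infS h).2|exists t].
have dge h c : (forall t, good h t -> c <= (f (x + t *: h) - f x) / t) -> c <= d h.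
  move=> H; apply: lb_le_inf; first exact: (infS h).1.
  by move=> _ [t tg <-]; exact: H.
have dZ0 h c : 0 < c -> c * d h <= d (c *: h).
  move=> c0; apply: (dge _ _) => t [t0 tr]; rewrite ler_pdivlMr// mulrC mulrA scalerA.
  apply: dle; split; first by rewrite mulr_gt0.
  by move: tr; rewrite sq.2 gtr0_norm// mulrA.
have dZ h c : 0 < c -> d (c *: h) = c * d h.
  move=> c0; apply/eqP; rewrite eq_le dZ0// andbT.
  have := dZ0 (c *: h) c^-1; rewrite invr_gt0 => /(_ c0).
  by rewrite scalerA mulVf ?gt_eqF// scale1r ler_pdivrMl.
have dD h k : d (h + k) <= d h + d k.
  rewrite -lerBlDr; apply: (dge _ _) => t tg; rewrite lerBlDr -lerBlDl.
  apply: (dge _ _) => u ug; rewrite lerBlDl.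
  have [t0 _] := tg; have [u0 _] := ug; have [g0 _] := gtP (h + k).
  pose w := Num.min (gt (h + k)) (Num.min (t / 2) (u / 2)).
  have w0 : 0 < w by rewrite !lt_min g0 !divr_gt0.
  have wg : w <= gt (h + k) by rewrite /w ge_min lexx.
  have wt : 2 * w <= t by rewrite mulrC -ler_pdivlMr// /w !ge_min lexx !orbT.
  have wu : 2 * w <= u by rewrite mulrC -ler_pdivlMr// /w !ge_min lexx !orbT.
  have w20 : 0 < 2 * w by rewrite mulr_gt0.
  have H1 := dle _ _ (good_small _ _ _ (gtP _) w0 wg).
  have H2 := chord_forward Dx (goodD _ _ tg) t0 (ltW w20) wt.
  have H3 := chord_forward Dx (goodD _ _ ug) u0 (ltW w20) wu.
  have := convf (goodD _ _ (good_small _ _ _ tg w20 wt))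
    (goodD _ _ (good_small _ _ _ ug w20 wu)) (_ : 0 <= 2^-1) (_ : 2^-1 <= 1).
  rewrite invr_ge0 ler0n invf_le1// ler1n => /(_ isT isT).
  rewrite conv_translate.
  have -> : 1 - 2^-1 = 2^-1 :> R by field.
  rewrite -scalerDr -scalerDr scalerA mulrA mulVf// mul1r.
  move=> H4; rewrite -(ler_pM2l w0); lra.
have d0 : d 0 = 0.
  by have := dZ 0 2 (ltr0Sn _ _); rewrite scaler0; lra.
have dN h : d (- h) = - d h.
  apply/eqP; rewrite eq_le; apply/andP; split; last first.
    by have := dD h (- h); rewrite subrr d0; lra.
  rewrite -subr_le0 opprK.
  (* Second differences are controlled only on the [q]-unit ball; homogeneity allows scaling [h]
     into it. *)
  pose c := (q h + 1)^-1.
  have c0 : 0 < c by rewrite invr_gt0 ltr_wpDl// seminorm_ge0.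
  have qc : q (c *: h) <= 1.
    rewrite sq.2 gtr0_norm// /c mulrC ler_pdivrMr ?mul1r ?lerDl//.
    by rewrite ltr_wpDl// seminorm_ge0.
  have : c * (d (- h) + d h) <= c * 0; last by rewrite ler_pM2l.
  rewrite mulr0 mulrDr -!dZ// scalerN; apply/ler_addgt0Pr => e e0; rewrite add0r.
  have [r1 r10 [rho rho0 /(_ x)]] := smx e e0.
  rewrite subrr (seminorm0 sq) => /(_ r10)[_].
  pose t := Num.min (rho / 2) (Num.min (gt (c *: h)) (gt (- (c *: h)))).
  have t0 : 0 < t by rewrite !lt_min divr_gt0// (gtP _).1 (gtP _).1.
  have tr : t < rho.
    by apply: (@le_lt_trans _ _ (rho / 2)); [rewrite /t ge_min lexx|lra].
  have t1 : t <= gt (c *: h) by rewrite /t !ge_min lexx !orbT.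
  have t2 : t <= gt (- (c *: h)) by rewrite /t !ge_min lexx !orbT.
  move=> /(_ t _ t0 tr qc).
  have := dle _ _ (good_small _ _ _ (gtP _) t0 t1).
  have := dle _ _ (good_small _ _ _ (gtP _) t0 t2).
  rewrite scalerN => H1 H2 H3.
  by rewrite -(ler_pM2l t0); lra.
have dlin : linear (d : V -> R^o).
  move=> a h k.
  have dDe h' k' : d (h' + k') = d h' + d k'.
    apply/eqP; rewrite eq_le dD//=.
    by have := dD (- h') (- k'); rewrite -opprD !dN; lra.
  rewrite dDe; congr (_ + _).
  have [a0|a0|->] := ltgtP a 0; last by rewrite !scale0r d0.
  - have -> : a *: h = - ((- a) *: h) by rewrite scaleNr opprK.
    by rewrite dN dZ ?oppr_gt0// mulNr opprK.
  - exact: dZ.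
pose dm := GRing.isLinear.Build R V R^o *:%R (d : V -> R^o) dlin.
pose df : {linear V -> R^o} := HB.pack (d : V -> R^o) dm.
exists df; split.
  exists L => h; change (`|d h| <= L * q h).
  have dlow k : - (L * q k) <= d k by apply: dge => t; exact: low.
  by rewrite ler_norml dlow/=; have := dlow (- h); rewrite dN (seminormN sq); lra.
move=> e e0; have [r1 r10 [rho rho0 /(_ x)]] := smx e e0.
rewrite subrr (seminorm0 sq) => /(_ r10)[_ smt].
exists (Num.min rho r); first by rewrite lt_min rho0.
have pos t h : 0 < t -> t < Num.min rho r -> q h <= 1 ->
    `|(f (x + t *: h) - f x) / t - d h| <= e.
  move=> t0; rewrite lt_min => /andP[trho tr] qh.
  have tq : t * q h < r by apply: le_lt_trans tr; rewrite ler_piMr ?(ltW t0).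
  have := dle h t (conj t0 tq).
  have := dle (- h) t (conj t0 _); rewrite (seminormN sq) => /(_ tq).
  have := smt t h t0 trho qh.
  rewrite dN scalerN => H1 H2 H3.
  have H4 : d h <= (f (x + t *: h) - f x) / t by rewrite ler_pdivlMr// mulrC.
  have H5 : (f (x + t *: h) - f x) / t <= d h + e.
    by rewrite ler_pdivrMr// mulrC; lra.
  by rewrite ler_norml; lra.
move=> t h t0 tr qh; change (`|(f (x + t *: h) - f x) / t - d h| <= e).
have [tn|tp|] := ltgtP t 0; last by move/eqP; rewrite (negbTE t0).
  have := pos (- t) (- h); rewrite oppr_gt0 (seminormN sq) scalerN scaleNr opprK.
  rewrite dN invrN mulrN -opprD normrN; apply=> //.
  by rewrite -ltr0_norm.
by apply: pos => //; rewrite -[t]gtr0_norm.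
Qed.

End ConvexSeminorm.

(** * Banach quotients of a quojection *)

Section Quojection.
Context {R : realType}.

Lemma continuous_linear_bound (X Y : normedModType R) (T : {linear X -> Y}) :
  continuous T -> exists2 k, 0 < k & forall x, `|T x| <= k * `|x|.
Proof.
move=> cT; have /linear_boundedP := continuous_linear_bounded 0 (cT 0).
by move=> /pinfty_ex_gt0[k k0 kP]; exists k.
Qed.

(** The norm of a projection is dominated by a multiple of that of any later one, so the sets
    bounding a single projection form a filter base. It converges to 0 in each coordinate, hence in
    the product. *)
Lemma projlim_nbhs0 (S : @banach_spectrum R) (U : set (projlim S)) : nbhs 0 U ->
  exists n, exists2 r, 0 < r &
    forall x : projlim S, `|@projlim_proj R S n x| < r -> U x.
Proof.
move=> [_ [[B Bo <-] B0] BU].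
pose G := filter_from [set nr : nat * R | 0 < nr.2]
  (fun nr => [set x : projlim S | `|@projlim_proj R S nr.1 x| < nr.2]).
have le_proj n m : (n <= m)%N -> exists2 k, 0 < k &
    forall x : projlim S, `|@projlim_proj R S n x| <= k * `|@projlim_proj R S m x|.
  move=> nm; have [k k0 kP] :=
    continuous_linear_bound (@bs_map_continuous R S n m nm).
  exists k => // x; have := valP (x : sub_tvs (projlim_pred (S:=S))).
  by rewrite inE => /(_ n m nm) xE; rewrite /projlim_proj -xE.
have FG : Filter G.
  apply: filter_from_filter; first by exists (0%N, 1) => /=.
  move=> [n r] [m s] /= r0 s0.
  have [k k0 kP] := le_proj n _ (leq_maxl n m).
  have [l l0 lP] := le_proj m _ (leq_maxr n m).
  exists (maxn n m, Num.min (r / k) (s / l)); first by rewrite /= lt_min !divr_gt0.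
  move=> x /=; rewrite lt_min !ltr_pdivlMr// => /andP[xr xs]; split.
    by apply: le_lt_trans (kP x) _; rewrite mulrC.
  by apply: le_lt_trans (lP x) _; rewrite mulrC.
pose val_S := @sub_tvs_val R (bs_prod S) (projlim_pred (S:=S)).
have : (val_S @ G) B.
  have B0' : nbhs (0 : bs_prod S) B by apply: open_nbhs_nbhs.
  apply: (tvs_prod_cvg (F := val_S @ G)) B0' => i.
  apply/cvgrPdist_lt => e e0; exists (i, e) => //= x.
  by rewrite /= sub0r normrN.
move=> [[n r] /= r0 nrB]; exists n, r => // x xr.
by apply: BU; exact: nrB.
Qed.

(** The bounds [M j] are uniform in [v]: the unit ball of [S m] is covered by the image of a bounded
    set. From level [m] upwards, preimages with norm control come from the open mapping theorem, one
    level at a time. *)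
Lemma projlim_lift (S : @banach_spectrum R) (m : nat) : strict_spectrum S ->
  exists M : nat -> R, forall v : S m, `|v| <= 1 ->
    exists x : projlim S, @projlim_proj R S m x = v /\
      forall j, `|@projlim_proj R S j x| <= M j.
Proof.
move=> strictS.
have lift n : {phi : S n -> S n.+1 | exists2 k, 0 < k &
    forall y, bs_map S n n.+1 (phi y) = y /\ `|phi y| <= k * `|y|}.
  apply: cid; have [|k k0 kP] :=
      open_mapping (@bs_map_continuous R S n n.+1 (leqnSn n)).
    move=> y; have [x xy] := strictS n y; exists (@projlim_proj R S n.+1 x).
    have := valP (x : sub_tvs (projlim_pred (S:=S))).
    by rewrite inE => /(_ n n.+1 (leqnSn n)); rewrite -xy.
  have /choice[phi phiP] : forall y, exists x : S n.+1,
      bs_map S n n.+1 x = y /\ `|x| <= k * `|y|.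
    by move=> y; have [x] := kP y; exists x.
  by exists phi, k.
pose phi n := sval (lift n); have phiP n := svalP (lift n).
pose w (v : S m) := fix w j : S (j + m)%N :=
  if j is i.+1 then phi (i + m)%N (w i) else v.
have wS v i : bs_map S (i + m)%N (i.+1 + m)%N (w v i.+1) = w v i.
  by have [k _ /(_ (w v i))[]] := phiP (i + m)%N.
have wD v i d : bs_map S (i + m)%N (d + i + m)%N (w v (d + i)%N) = w v i.
  elim: d => [|d IH]; first exact: bs_map_id.
  rewrite -(@bs_map_comp R S (i + m)%N (d + i + m)%N (d.+1 + i + m)%N).
    by rewrite -[(d.+1 + i)%N]/(d + i).+1 wS.
  by apply/andP; split; rewrite leq_add2r ?leq_addl ?leqnSn.
have wle v i j : (i <= j)%N -> bs_map S (i + m)%N (j + m)%N (w v j) = w v i.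
  by move=> ij; have := wD v i (j - i)%N; rewrite subnK.
have /choice[K KP] : forall j, exists K, 0 <= K /\ forall v, `|w v j| <= K * `|v|.
  elim=> [|j [K [K0 KP]]]; first by exists 1; split=> // v; rewrite mul1r.
  have [k k0 kP] := phiP (j + m)%N.
  exists (k * K); split=> [|v]; first by rewrite mulr_ge0// ltW.
  apply: le_trans (kP (w v j)).2 _.
  by rewrite -mulrA ler_wpM2l// ltW.
have /choice[C CP] : forall j, exists k, 0 < k /\
    forall z, `|bs_map S j (j + m)%N z| <= k * `|z|.
  move=> j; have [k k0 kP] :=
    continuous_linear_bound (@bs_map_continuous R S j (j + m)%N (leq_addr m j)).
  by exists k.
exists (fun j => C j * K j) => v v1.
(* [w v j] lives at level [j + m]; mapping it down to level [j] treats the levels below and above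
   [m] alike. *)
pose u : bs_prod S := TvsProd (fun j => bs_map S j (j + m)%N (w v j)).
have uP : u \in projlim_pred (S:=S).
  apply/asboolP => i j ij.
  rewrite /tvs_coord/= (@bs_map_comp R S i j (j + m)%N) ?ij ?leq_addr//.
  rewrite -[in RHS](wle v i j ij) (@bs_map_comp R S i (i + m)%N (j + m)%N)//.
  by rewrite leq_addr leq_add2r.
exists (SubTvs uP); split.
  rewrite /projlim_proj/= /tvs_coord/=.
  by rewrite (wle v 0%N m).
move=> j; rewrite /projlim_proj/= /tvs_coord/=.
apply: le_trans ((CP j).2 _) _; rewrite ler_pM2l ?(CP j).1//.
apply: le_trans ((KP j).2 v) _.
by rewrite ler_piMr ?(KP j).1.
Qed.

Lemma quojection_quotients (E : tvsType R) : quojection E ->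
  exists (X : nat -> completeNormedModType R) (Q : forall n, {linear E -> X n}),
  [/\ forall n, continuous (Q n),
      forall U : set E, nbhs 0 U ->
        exists n, exists2 r, 0 < r & forall x, `|Q n x| < r -> U x &
      forall n, exists M : nat -> R, forall v, `|v| <= 1 ->
        exists x, Q n x = v /\ forall j, `|Q j x| <= M j].
Proof.
move=> [_ [S [strictS [f [g [fK gK cf cg]]]]]].
pose Q n : {linear E -> S n} :=
  tvs_coord n \o ((\val : sub_tvs (projlim_pred (S:=S)) -> bs_prod S) \o f).
exists S, Q; split.
- move=> n x; apply: continuous_comp; last exact: tvs_coord_continuous.
  by apply: continuous_comp; [exact: cf|exact: sub_tvs_val_continuous].
- move=> U U0; have : nbhs 0 (g @^-1` U) by apply: cg; rewrite linear0.
  move=> /projlim_nbhs0[n [r r0 nrU]]; exists n, r => // x xr.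
  by have := nrU (f x) xr; rewrite /= fK.
- move=> n; have [M MP] := projlim_lift n strictS; exists M => v /MP[x [xv xM]].
  by exists (g x); split=> [|j]; rewrite /Q/= gK//; exact: xM.
Qed.

End Quojection.

(** * Banach quotients and Frechet differentiability *)

Section FrechetQuotients.
Context {R : realType}.

Lemma uniform_dnbhs0P (T : choiceType) (B : set T) (F : R -> T -> R^o)
    (g : T -> R^o) :
  {uniform B, F @ 0^' --> g} <->
  forall e, 0 < e -> exists2 d, 0 < d &
    forall t y, t != 0 -> `|t| < d -> B y -> `|g y - F t y| < e.
Proof.
split=> [H e e0|H P /uniform_nbhs[A [entA AP]]].
  have : nbhs (g : {uniform` B -> R^o}) [set h | forall y, B y -> `|g y - h y| < e].
    apply/uniform_nbhs; exists [set xy | ball xy.1 e xy.2]; split.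
      exact: (@entourage_ball _ R^o (PosNum e0)).
    by move=> h /= hB y By; have := hB y By; rewrite -ball_normE.
  move=> /H; rewrite /= /nbhs/= => /nbhs_ballP[d /= d0 dP].
  exists d => // t y t0 td; apply: (dP t) => //.
  by rewrite -ball_normE/= sub0r normrN.
have [e /= e0 eA] : exists2 e : R, 0 < e &
    [set xy : R^o * R^o | ball xy.1 e xy.2] `<=` A.
  by move: entA; rewrite -entourage_ballE => -[e e0 eA]; exists e.
have [d d0 dP] := H e e0.
apply/nbhs_ballP; exists d => //= t; rewrite -ball_normE/= sub0r normrN => td t0.
by apply: AP => y By; apply: eA; rewrite /= -ball_normE/=; exact: dP.
Qed.

Section QuotientMaps.
Variables (E : tvsType R) (X : nat -> completeNormedModType R).
Variable Q : forall n, {linear E -> X n}.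
Hypothesis Qcont : forall n, continuous (Q n).
Hypothesis Qbasis : forall U : set E, nbhs 0 U ->
  exists n, exists2 r, 0 < r & forall x, `|Q n x| < r -> U x.
Hypothesis Qlift : forall n, exists M : nat -> R, forall v, `|v| <= 1 ->
  exists x, Q n x = v /\ forall j, `|Q j x| <= M j.

Lemma quotient_nbhs n (x : E) e : 0 < e -> nbhs x [set y | `|Q n (y - x)| < e].
Proof.
move=> e0; have /cvgrPdist_lt /(_ e e0) := Qcont (n := n) (x := x).
by apply: filterS => y; rewrite -linearB -opprB linearN normrN.
Qed.

Lemma bounded_quotients (M : nat -> R) :
  tvs_bounded [set x : E | forall j, `|Q j x| <= M j].
Proof.
move=> U /Qbasis[n [r r0 nrU]].
have M1 : 0 < `|M n| + 1 by rewrite ltr_wpDl.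
near=> s => x /(_ n) xM.
have s0 : 0 < s by [].
exists (s^-1 *: x); last by rewrite scalerA divff ?gt_eqF// scale1r.
apply: nrU; rewrite linearZ/= normrZ gtr0_norm ?invr_gt0// ltr_pdivrMl//.
apply: (@lt_le_trans _ _ (`|M n| + 1)).
  by rewrite (le_lt_trans xM)// (le_lt_trans (ler_norm _))// ltrDl.
by rewrite -ler_pdivrMr//; near: s; apply: nbhs_pinfty_ge; rewrite num_real.
Unshelve. all: by end_near. Qed.

Lemma quotient_open n (U : set E) : nbhs 0 U ->
  exists2 s, 0 < s & forall v, `|v| < s -> exists2 x, U x & Q n x = v.
Proof.
move=> /Qbasis[m [r r0 mrU]]; have [M MP] := Qlift n.
have M1 : 0 < `|M m| + 1 by rewrite ltr_wpDl.
pose s := r / (`|M m| + 1).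
have s0 : 0 < s by rewrite divr_gt0.
exists s => // v vs; have [|x [xv xM]] := MP (s^-1 *: v).
  by rewrite normrZ gtr0_norm ?invr_gt0// ler_pdivrMl// mulr1 ltW.
exists (s *: x); last by rewrite linearZ/= xv scalerA divff ?gt_eqF// scale1r.
apply: mrU; rewrite linearZ/= normrZ gtr0_norm// /s mulrAC ltr_pdivrMr//.
rewrite ltr_pM2l// (le_lt_trans (xM m))// (le_lt_trans (ler_norm _))// ltrDl//.
Qed.

Lemma quotient_surj n v : exists x, Q n x = v.
Proof.
have [M MP] := Qlift n; have v1 : 0 < `|v| + 1 by rewrite ltr_wpDl.
have [|x [xv _]] := MP ((`|v| + 1)^-1 *: v).
  by rewrite normrZ gtr0_norm ?invr_gt0// ler_pdivrMl// mulr1 lerDl.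
exists ((`|v| + 1) *: x).
by rewrite linearZ/= xv scalerA divff ?gt_eqF// scale1r.
Qed.

(** [s] is continuous and convex on [E], hence Frechet differentiable somewhere, and its value at
    [x] depends on [Q m x] alone. Uniformity on a bounded set of lifts of the unit ball of [X m]
    thus gives the estimate on the whole ball. *)
Lemma asplund_flat_quotients : asplund E ->
  forall m, flat_seminorm (fun x => `|Q m x|).
Proof.
move=> [_ aspE] m s L ss sL e e0.
have sB x y : s x - s y <= `|L| * `|Q m (x - y)|.
  have := ss.1 (x - y) y; rewrite subrK => H.
  apply: (@le_trans _ _ (s (x - y))); first by rewrite lerBlDr.
  by apply: le_trans (sL _) _; rewrite ler_wpM2r// ler_norm.
have scont : continuous (s : E -> R^o).
  move=> x; apply/cvgrPdist_lt => d d0.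
  have L1 : 0 < `|L| + 1 by rewrite ltr_wpDl.
  have := quotient_nbhs m x (divr_gt0 d0 L1); apply: filterS => y.
  rewrite /= ltr_pdivlMr// => yd.
  have := sB x y; have := sB y x.
  rewrite -(opprB y x) linearN normrN => H1 H2.
  apply: (@le_lt_trans _ _ (`|L| * `|Q m (y - x)|)).
    by rewrite ler_norml; lra.
  have := normr_ge0 (Q m (y - x)); lra.
have [|||||G [_ _ GD Gdiff]] := aspE setT s.
- by exists 0.
- exact: openT.
- by move=> x y l _ _; rewrite inE.
- exact: continuous_subspaceT.
- move=> t x y _ _; apply: le_trans (ss.1 _ _) _.
  by rewrite !ss.2 ?subr_ge0.
have [z Gz] : G !=set0.
  have [z [Gz _]] := GD 0 Logic.I setT (filterT); by exists z.
have [df _ dfP] := Gdiff z Gz.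
have [M MP] := Qlift m.
(* The quotients at [d / 2] and [- (d / 2)] both lie within [e / 2] of the same [df b]. *)
have e2 : 0 < e / 2 by rewrite divr_gt0.
have /uniform_dnbhs0P /(_ _ e2) [d d0 dP] := dfP _ (@bounded_quotients M).
exists z, (d / 2); first by rewrite divr_gt0.
move=> h /MP[b [bh bM]].
have d20 : 0 < d / 2 by rewrite divr_gt0.
have sb a : s (z + a *: h) <= s (z + a *: b).
  have := sB (z + a *: h) (z + a *: b).
  rewrite opprD addrACA subrr add0r -scalerBr linearZ/= linearB/= bh subrr.
  by rewrite scaler0 normr0 mulr0 subr_le0.
have := dP (d / 2) b; have := dP (- (d / 2)) b.
rewrite oppr_eq0 normrN gtr0_norm// (gt_eqF d20) => /(_ isT _ bM) H1 /(_ isT _ bM) H2.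
have {}H1 := H1 (_ : d / 2 < d); have {}H2 := H2 (_ : d / 2 < d).
have d2d : d / 2 < d by lra.
move: (H1 d2d) (H2 d2d); rewrite invrN mulrN opprK.
have := sb (d / 2); have := sb (- (d / 2)); rewrite !scaleNr.
set A := s (z + (d / 2) *: b); set B := s (z - (d / 2) *: b) => H3 H4.
rewrite !ltr_norml => /andP[_ H5] /andP[H6 _].
have H7 : (A - s z) / (d / 2) + (B - s z) / (d / 2) <= e by lra.
by move: H7; rewrite -mulrDl ler_pdivrMr//; lra.
Qed.

End QuotientMaps.

End FrechetQuotients.

(** * Passing flatness to a subspace *)

Section SubspaceAsplund.
Context {R : realType}.

(** Some [P m] dominates [Q n] on [G], and by [almost_open] the closure of the image of a multiple
    of its unit ball contains the unit ball of [Y n]. It remains to bring near flatness down from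
    [E], at the price of a factor 3. *)
Lemma flat_subspace (E G : tvsType R) (i : {linear G -> E})
    (X Y : nat -> completeNormedModType R)
    (P : forall n, {linear E -> X n}) (Q : forall n, {linear G -> Y n}) :
  (forall U : set E, nbhs 0 U ->
     exists n, exists2 r, 0 < r & forall x, `|P n x| < r -> U x) ->
  (forall U : set G, nbhs 0 U -> exists2 W : set E, nbhs 0 W & i @^-1` W `<=` U) ->
  (forall n, continuous (Q n)) -> (forall n v, exists x, Q n x = v) ->
  (forall m, flat_seminorm (fun x => `|P m x|)) ->
  forall n, flat_seminorm (fun x => `|Q n x|).
Proof.
move=> Pbasis iemb Qcont Qsurj flatP n.
have sQ := seminorm_norm (Q n).
have U0 : nbhs 0 [set x | `|Q n x| < 1].
  have := quotient_nbhs Qcont n 0 ltr01; apply: filterS => x /=.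
  by rewrite subr0.
have [W W0 WU] := iemb _ U0.
have [m [r r0 mrW]] := Pbasis W W0.
have siP : seminorm (fun x => `|P m (i x)|) := seminorm_norm (P m \o i).
have QP := seminorm_comparison siP sQ r0 (fun x xr => WU x (mrW _ xr)).
have [k k0 kP] := almost_open siP (Qsurj n).
apply: (flat_dense_image (p := fun x => `|P m (i x)|) sQ k0).
  move=> h /kP kh eta /kh [x xk hx]; exists (k^-1 *: x).
    by rewrite !linearZ/= normrZ gtr0_norm ?invr_gt0// ler_pdivrMl// mulr1.
  by rewrite scalerA divff ?gt_eqF// scale1r linearB -opprB normrN.
move=> s L ss sL e e0.
pose c := `|L| * r^-1.
have c0 : 0 <= c by rewrite mulr_ge0 ?invr_ge0 ?(ltW r0).
have e3 : 0 < e / 3 by rewrite divr_gt0.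
have -> : e = 3 * (e / 3) by field.
have sp : sublinear (fun x => c * `|P m x|).
  have [pD pZ] := seminorm_sublinear (seminorm_norm (P m)).
  split=> [x y|t x t0]; first by rewrite -mulrDr ler_wpM2l.
  by rewrite pZ// mulrCA.
apply: (nearly_flat_restrict (p := fun x => c * `|P m x|)
  (q := fun x => `|P m x|)) => //.
  move=> y; apply: le_trans (sL y) _.
  apply: (@le_trans _ _ (`|L| * `|Q n y|)); first by rewrite ler_wpM2r// ler_norm.
  by rewrite /c -mulrA ler_wpM2l.
by move=> g sg gp; exact: flatP sg gp _ e3.
Qed.

Lemma metrizable_hausdorff (T : topologicalType) :
  metrizable R T -> hausdorff_space T.
Proof.
move=> [d [d_ge0 d0 dC dT dnbhs]] x y xy; apply/d0/eqP.
rewrite eq_le d_ge0 andbT; apply/ler_addgt0Pr => e e0; rewrite add0r.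
have e2 : 0 < e / 2 by rewrite divr_gt0.
have near z : nbhs z [set w | d z w < e / 2] by rewrite dnbhs; exists (e / 2).
have [z [xz yz]] := xy _ _ (near x) (near y).
by have := dT x z y; rewrite (dC z y); move: xz yz => /=; lra.
Qed.

(** * From flat quotients to the Asplund property *)

Section Asplund.
Variables (E : tvsType R) (X : nat -> completeNormedModType R).
Variable Q : forall n, {linear E -> X n}.
Hypothesis Qcont : forall n, continuous (Q n).
Hypothesis Qbasis : forall U : set E, nbhs 0 U ->
  exists n, exists2 r, 0 < r & forall x, `|Q n x| < r -> U x.
Hypothesis Qlift : forall n, exists M : nat -> R, forall v, `|v| <= 1 ->
  exists x, Q n x = v /\ forall j, `|Q j x| <= M j.
Hypothesis Qflat : forall n, flat_seminorm (fun x => `|Q n x|).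

Lemma nbhs_translate (x : E) (U : set E) : nbhs x U -> nbhs 0 [set h | U (x + h)].
Proof.
move=> Ux; have /(_ U) := @add_continuous E (x, 0).
rewrite /= addr0 => /(_ Ux) [[A B] /= [Ax B0] AB].
apply: filterS B0 => h Bh; apply: (AB (x, h)); split=> //=.
exact: nbhs_singleton.
Qed.

Lemma bounded_seminorm n (B : set E) : tvs_bounded B ->
  exists2 c, 0 < c & forall y, B y -> `|Q n y| <= c.
Proof.
move=> bB; have U0 : nbhs 0 [set x : E | `|Q n x| < 1].
  have := quotient_nbhs Qcont n 0 ltr01; apply: filterS => x /=.
  by rewrite subr0.
have /pinfty_ex_gt0[c c0 cB] := bB _ U0; exists c => // y /cB[u /= u1 <-].
by rewrite linearZ/= normrZ gtr0_norm// ger_pMr// ltW.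
Qed.

Lemma frechet_differentiable_quotient n (f : E -> R^o) (x : E)
    (df : {linear E -> R^o}) :
  (exists L, forall h, `|df h| <= L * `|Q n h|) ->
  (forall e, 0 < e -> exists2 rho, 0 < rho & forall t h, t != 0 -> `|t| < rho ->
      `|Q n h| <= 1 -> `|(f (x + t *: h) - f x) / t - df h| <= e) ->
  frechet_differentiable f x.
Proof.
move=> [L dfL] dfP; exists df.
  move=> y; apply/cvgrPdist_lt => d d0.
  have L1 : 0 < `|L| + 1 by rewrite ltr_wpDl.
  have := quotient_nbhs Qcont n y (divr_gt0 d0 L1); apply: filterS => z.
  rewrite /= ltr_pdivlMr// => zd; rewrite distrC -linearB.
  apply: le_lt_trans (dfL _) _; apply: le_lt_trans zd; rewrite mulrC.
  by rewrite ler_wpM2l// (le_trans (ler_norm L))// lerDl.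
move=> B /(bounded_seminorm n)[c c0 Bc]; apply/uniform_dnbhs0P => e e0.
(* Scaling [B] into the unit ball costs the factor [c]; the 2 makes the final inequality strict. *)
have ec0 : 0 < e / (2 * c) by rewrite divr_gt0// mulr_gt0.
have [rho rho0 rhoP] := dfP _ ec0.
exists (rho / c); first by rewrite divr_gt0.
move=> t y t0; rewrite ltr_pdivlMr// => tc /Bc yc.
have tc0 : t * c != 0 by rewrite mulf_neq0// gt_eqF.
have tcr : `|t * c| < rho by rewrite normrM (gtr0_norm c0).
have qy : `|Q n (c^-1 *: y)| <= 1.
  by rewrite linearZ/= normrZ gtr0_norm ?invr_gt0// ler_pdivrMl// mulr1.
have := rhoP _ _ tc0 tcr qy.
rewrite scalerA mulfK ?gt_eqF// linearZ/= => H.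
rewrite distrC.
have -> : (f (x + t *: y) - f x) / t - df y =
    c * ((f (x + t *: y) - f x) / (t * c) - c^-1 *: df y).
  rewrite mulrBr; congr (_ - _); first by field; rewrite t0 gt_eqF.
  by rewrite -[_ *: df y]/(c^-1 * df y) mulrA divff ?gt_eqF// mul1r.
rewrite normrM gtr0_norm//; apply: (@le_lt_trans _ _ (c * (e / (2 * c)))).
  by rewrite ler_pM2l.
have -> : c * (e / (2 * c)) = e / 2 by field; rewrite gt_eqF.
lra.
Qed.

Lemma flat_quotients_asplund : hausdorff_space E -> asplund E.
Proof.
move=> hE; split=> // D f [x1 Dx1] oD cD fcont cf.
have convD x y (l : R) : D x -> D y -> 0 <= l -> l <= 1 ->
    D (l *: x + (1 - l) *: y).
  move=> Dx Dy l0 l1; apply: set_mem.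
  exact: (cD x y (Itv01 l0 l1) (mem_set Dx) (mem_set Dy)).
have convf x y (l : R) : D x -> D y -> 0 <= l -> l <= 1 ->
    f (l *: x + (1 - l) *: y) <= l * f x + (1 - l) * f y.
  move=> Dx Dy l0 l1.
  exact: (cf (Itv01 l0 l1) x y (mem_set Dx) (mem_set Dy)).
have nearD x : D x -> exists n, exists2 r, 0 < r &
    forall h, `|Q n h| < r -> D (x + h).
  by move=> Dx; apply/Qbasis/nbhs_translate/open_nbhs_nbhs.
(* The index [n] is fixed here, by boundedness of [f] near one point; [convex_locally_bounded] makes
   it serve on all of [D]. *)
have [n [r r0 x1r]] : exists n, exists2 r, 0 < r &
    forall h, `|Q n h| < r -> D (x1 + h) /\ f (x1 + h) <= f x1 + 1.
  apply: Qbasis; apply: (nbhs_translate (U := [set y | D y /\ f y <= f x1 + 1])).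
  have : {for x1, continuous f}.
    by move: fcont; rewrite continuous_open_subspace// => /(_ x1); apply; rewrite inE.
  move=> /cvgrPdist_lt /(_ 1 ltr01) fx1.
  apply: filterS2 (open_nbhs_nbhs (conj oD Dx1)) fx1 => y Dy /=.
  by rewrite ltr_norml => /andP[] H1 H2; split=> //; lra.
pose q x := `|Q n x|; have sq : seminorm q := seminorm_norm (Q n).
have x1b y : q (y - x1) < r -> D y /\ f y <= f x1 + 1.
  by move=> /x1r; rewrite subrKC.
have lipf u : D u -> exists r L : R, [/\ 0 < r, 0 <= L,
    forall y, q (y - u) < r -> D y &
    forall x y, q (x - u) < r -> q (y - u) < r -> f x - f y <= L * q (x - y)].
  move=> Du; have [|r' r'0 [M uM]] := convex_locally_bounded sq convD convf r0 x1b Du.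
    (* Openness of [D] at [u] may involve another index [m]; it serves to prolong the segment from
       [x1] slightly beyond [u]. *)
    have [m [s s0 us]] := nearD u Du.
    have m1 : 0 < `|Q m (u - x1)| + 1 by rewrite ltr_wpDl.
    exists (s / (`|Q m (u - x1)| + 1)); first by rewrite divr_gt0.
    apply: us; rewrite linearZ/= normrZ gtr0_norm ?divr_gt0//.
    by rewrite mulrAC ltr_pdivrMr// ltr_pM2l// ltrDl.
  have [L L0 lip] := convex_locally_lipschitz sq convf r'0 uM.
  exists (r' / 2), L; split=> //; first by rewrite divr_gt0.
  by move=> y yu; apply: (uM y _).1; lra.
pose O k := [set u | smooth_near D f q k.+1%:R^-1 u].
have k0 k : 0 < k.+1%:R^-1 :> R by rewrite invr_gt0 ltr0Sn.
have OD k u : O k u -> D u.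
  move=> [s s0 [t _ /(_ u)]]; rewrite subrr (seminorm0 sq) => /(_ s0).
  by case.
have Oo k : open (O k).
  rewrite openE => u /(smooth_near_open sq)[s s0 us].
  by apply: filterS (quotient_nbhs Qcont n u s0) => v; exact: us.
(* [O k] is a union of fibres of [Q n], so every lift of a point of its image stays in [O k]. This
   lets Baire's theorem be applied in the Banach space [X n]. *)
have Osat k u v : O k u -> Q n u = Q n v -> O k v.
  move=> /(smooth_near_open sq)[s s0 us] uv; apply: us.
  by rewrite /q linearB uv subrr normr0.
exists (\bigcap_k O k); split.
- by move=> u /(_ 0%N Logic.I); exact: OD.
- by exists O.
- move=> x Dx W Wx.
  have W0 : nbhs 0 [set h | W (x + h) /\ D (x + h)].
    apply: (nbhs_translate (U := W `&` D)); apply: filterI => //.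
    exact/open_nbhs_nbhs.
  have [s s0 sW] := quotient_open Qbasis Qlift n W0.
  have surjQ := quotient_surj Qlift (n := n).
  (* Outside the image of [D] nothing is required of the dense open sets. *)
  pose A k := (Q n @` O k) `|` (~` (Q n @` D))^°.
  have QO k : open (Q n @` O k).
    rewrite openE => _ [u /[dup] Ou /(smooth_near_open sq)[t t0 ut] <-].
    apply/nbhs_ballP; exists t => //= w; rewrite -ball_normE/= distrC => wt.
    have [v vw] := surjQ w; exists v => //; apply: ut.
    by rewrite /q linearB/= vw.
  have /Baire : forall k, open (A k) /\ dense (A k).
    move=> k; split; first by apply: openU => //; exact: open_interior.
    move=> B [b Bb] Bo.
    have [[c [Bw [w Dw wc]]]|BD] := pselect (B `&` (Q n @` D) !=set0).
      rewrite -wc in Bw.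
      have [/= t t0 tB] : nbhs_ball (Q n w) B.
        by rewrite nbhs_ballE; exact: open_nbhs_nbhs.
      have [u uw us] := smooth_near_dense sq convf lipf (@Qflat n) Dw t0 (k0 k).
      exists (Q n u); split; last by left; exists u.
      by apply: tB; rewrite -ball_normE/= distrC -linearB.
    exists b; split=> //; right.
    by apply: filterS (open_nbhs_nbhs (conj Bo Bb)) => c Bc Dc; apply: BD; exists c.
  move=> /(_ (ball (Q n x) s)) [||v [xv Av]].
  + by exists (Q n x); exact: ballxx.
  + exact: ball_open.
  have [h [Wh Dh] hv] : exists2 h, W (x + h) /\ D (x + h) & Q n h = v - Q n x.
    by apply: sW; rewrite distrC; move: xv; rewrite -ball_normE.
  exists (x + h); split=> // k _.
  have Qv : Q n (x + h) = v by rewrite linearD/= hv subrKC.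
  have [[u Ou uv]|/interior_subset] := Av k Logic.I.
    by apply: Osat Ou _; rewrite uv Qv.
  by case; exists (x + h).
- move=> x Ox; have Dx : D x := OD 0%N x (Ox 0%N Logic.I).
  have [|df [dfL dfP]] := smooth_differentiable sq convf lipf Dx.
    move=> e e0; apply: (smooth_near_le _ (Ox (Num.trunc e^-1) Logic.I)).
    rewrite -[leRHS]invrK lef_pV2 ?posrE ?ltr0Sn ?invr_gt0//.
    exact/ltW/truncnS_gt.
  exact: frechet_differentiable_quotient dfL dfP.
Qed.

End Asplund.

End SubspaceAsplund.

Theorem theorem6p5 (R : realType) (E : tvsType R) (F : submodClosed E) :
  quojection E -> asplund E ->
  closed [set x : E | x \in F] -> quojection (sub_tvs F) ->
  asplund (sub_tvs F).
Proof.
move=> quoE aspE _ quoF.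
have [X [P [Pcont Pbasis Plift]]] := quojection_quotients quoE.
have [Y [Q [Qcont Qbasis Qlift]]] := quojection_quotients quoF.
apply: (flat_quotients_asplund Qcont Qbasis Qlift); last first.
  exact: metrizable_hausdorff quoF.1.1.
apply: (@flat_subspace _ E (sub_tvs F) \val _ _ P) => //.
- move=> U [_ [[W Wo <-] W0] WU]; exists W; last exact: WU.
  by apply: open_nbhs_nbhs; split=> //; rewrite -(linear0 (\val : sub_tvs F -> E)).
- exact: quotient_surj.
- exact: asplund_flat_quotients.
Qed.
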